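(* Let $q=4$ and $\lambda=\frac{9996}{10000}$. There is a constant $C>0$ such that for every list-coloring instance $(G,L)$, $G=(V,E)$, satisfying $|L(u)|\ge\deg_G(u)+1$ for every $u\in V$, every vertex $v\in V$, every color $i\in[4]$ and every integer $D\ge3$, $$\bigl|P(G,L,v,i,D)-\Pr_{G,L}[c(v)=i]\bigr|\le C\cdot\lambda^{D-3}.$$
   Context: Colors are $[4]=\{1,2,3,4\}$ (so the condition $|L(u)|\ge\deg_G(u)+1$ forces maximum degree at most $3$). A list-coloring instance $(G,L)$ is a finite simple graph $G=(V,E)$ with $L:V\to 2^{[4]}$; a proper coloring is $c:V\to[4]$ with $c(u)\in L(u)$ for all $u$ and $c(u)\ne c(w)$ on every edge; $\Pr_{G,L}[c(v)=i]$ is the probability that $c(v)=i$ for $c$ uniform over proper colorings of $(G,L)$. For a vertex $v$, $G_v$ is $G$ with $v$ and its incident edges removed, and $G_{v,w}=(G_v)_w$. If $v$ has neighbors $v_1,\dots,v_d$ (in a fixed order), then for $k\in[d]$ and a color $j$, $L_{k,j}$ is the list assignment on $G_v$ with $L_{k,j}(v_\ell)=L(v_\ell)\setminus\{j\}$ for $\ell<k$ and $L_{k,j}(u)=L(u)$ for all other vertices $u$ (so $L_{1,j}=L$). The procedure $P(G,L,v,i,D)$ ($i\in[4]$, $D$ an integer) is defined recursively (empty products equal $1$): (a) If $i\notin L(v)$, return $0$. Otherwise, if $D\le 0$ or $\deg_G(v)=0$, return $1/|L(v)|$. (b) If $\deg_G(v)=1$ with neighbor $v_1$: let $x=P(G_v,L,v_1,i,D-1)$.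 If $|L(v)|=2$, say $L(v)=\{i,j\}$, let $y=P(G_v,L,v_1,j,D-1)$ and return $\frac{1-x}{2-x-y}$. If $|L(v)|=4$, return $\frac{1-x}{3}$. If $|L(v)|=3$, let $j$ be the unique color in $[4]\setminus L(v)$, $y=P(G_v,L,v_1,j,D-1)$, and return $\frac{1-x}{2+y}$. (c) If $\deg_G(v)=2$: order its neighbors $v_1,v_2$ so that $\deg_G(v_1)\ge\deg_G(v_2)$ and, if $\deg_G(v_1)=\deg_G(v_2)=1$, so that $i\notin L(v_1)$ implies $i\notin L(v_2)$. Let $u_1,\dots,u_{d_1}$ be the neighbors of $v_1$ in $G_v$ (fixed order) and for $k\in[d_1]$, $w\in[4]$ let $L'_{k,w}$ be the list assignment on $G_{v,v_1}$ with $L'_{k,w}(u_\ell)=L(u_\ell)\setminus\{w\}$ for $\ell<k$ and $L'_{k,w}(u)=L(u)$ otherwise. Set $x_{k,w}=P(G_{v,v_1},L'_{k,w},u_k,w,D-1)$ for $k\in[d_1]$, $w\in L(v_1)$. For $j\in L(v)$ set $f_j=0$ if $j\notin L(v_1)$ and otherwise $f_j=\frac{\prod_{k=1}^{d_1}(1-x_{k,j})}{\sum_{w\in L(v_1)}\prod_{k=1}^{d_1}(1-x_{k,w})}$, and set $y_j=P(G_v,L_{2,j},v_2,j,D-1)$. Return $\frac{(1-f_i)(1-y_i)}{\sum_{j\in L(v)}(1-f_j)(1-y_j)}$. (d) If $\deg_G(v)=3$ with neighbors $v_1,v_2,v_3$: for $j\in L(v)$ let $x_j=P(G_v,L_{1,j},v_1,j,D-1)$,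 $y_j=P(G_v,L_{2,j},v_2,j,D-1)$, $z_j=P(G_v,L_{3,j},v_3,j,D-1)$, and return $\frac{(1-x_i)(1-y_i)(1-z_i)}{\sum_{j\in L(v)}(1-x_j)(1-y_j)(1-z_j)}$. *)

(* Defs.v *)
From mathcomp Require Import all_boot all_order all_algebra.
Set Implicit Arguments. Unset Strict Implicit. Unset Printing Implicit Defensive.
Import Order.TTheory GRing.Theory Num.Theory.
Local Open Scope ring_scope.

(* Colors: 'I_4 = {0,1,2,3}, color k in 'I_4 stands for color k+1 of [4].
   A graph G = (V,E) is represented inside an ambient finite type T with a
   symmetric irreflexive edge relation e; the current vertex set is S : {set T}
   (so G_v is obtained by S :\ v, keeping e restricted to S).
   Lists: L : T -> {set 'I_4}.
   nb S v : the "fixed order" of the neighbours of v in the graph induced on S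
   (an arbitrary duplicate-free enumeration, see hypothesis nb_ok). *)

Section Defs.
Variable R : realFieldType.
Variable T : finType.
Variable e : rel T.
Variable nb : {set T} -> T -> seq T.

Definition nb_ok : Prop :=
  forall (S : {set T}) (v : T),
    uniq (nb S v) /\ forall w, (w \in nb S v) = (w \in S) && e v w.

Definition remove_on (s : seq T) (j : 'I_4) (L : T -> {set 'I_4}) : T -> {set 'I_4} :=
  fun u => if u \in s then L u :\ j else L u.

Definition inv_card (A : {set 'I_4}) : R := (#|A|%:R)^-1.

(* The procedure P(G,L,v,i,D), with G the graph induced by e on S.
   D is a natural number; D = 0 plays the role of D <= 0 (the theorem only
   uses D >= 3 and every recursive call decreases D by one). *)
Fixpoint P (D : nat) (S : {set T}) (L : T -> {set 'I_4}) (v : T) (i : 'I_4)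
  {struct D} : R :=
  if i \notin L v then 0 else
  match D with
  | 0%N => inv_card (L v)
  | D'.+1 =>
    let Sv := S :\ v in
    match nb S v with
    | [::] => inv_card (L v)
    | [:: v1] =>
        let x := P D' Sv L v1 i in
        if #|L v| == 2%N then
          let j := odflt i [pick j in L v :\ i] in
          let y := P D' Sv L v1 j in
          (1 - x) / (2 - x - y)
        else if #|L v| == 4%N then (1 - x) / 3
        else if #|L v| == 3%N then
          let j := odflt i [pick j | j \notin L v] in
          let y := P D' Sv L v1 j in
          (1 - x) / (2 + y)
        else inv_card (L v) (* unreachable under |L(u)| >= deg(u)+1 *)
    | [:: a; b] =>
        (* order v1, v2: deg_G(v1) >= deg_G(v2), and if both have degree 1,
           (i \notin L v1) -> (i \notin L v2) *)
        let da := size (nb S a) in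
        let db := size (nb S b) in
        let swap := (da < db)%N ||
                    [&& da == 1%N, db == 1%N, i \notin L a & i \in L b] in
        let v1 := if swap then b else a in
        let v2 := if swap then a else b in
        let us := nb Sv v1 in
        let Svv1 := Sv :\ v1 in
        let g (w : 'I_4) : R :=
          \prod_(k < size us)
             (1 - P D' Svv1 (remove_on (take k us) w L) (nth v us k) w) in
        let f (j : 'I_4) : R :=
          if j \in L v1 then g j / \sum_(w in L v1) g w else 0 in
        let y (j : 'I_4) : R := P D' Sv (remove_on [:: v1] j L) v2 j in
        (1 - f i) * (1 - y i) / \sum_(j in L v) (1 - f j) * (1 - y j)
    | [:: a; b; c] =>
        let t (j : 'I_4) : R :=
          (1 - P D' Sv (remove_on [::] j L) a j)
          * (1 - P D' Sv (remove_on [:: a] j L) b j)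
          * (1 - P D' Sv (remove_on [:: a; b] j L) c j) in
        t i / \sum_(j in L v) t j
    | _ => inv_card (L v) (* degree > 3: unreachable under the hypothesis *)
    end
  end.

Definition deg (u : T) : nat := #|[set w | e u w]|.

Definition proper_col (L : T -> {set 'I_4}) (c : {ffun T -> 'I_4}) : bool :=
  [forall u, c u \in L u] && [forall u, forall w, e u w ==> (c u != c w)].

Definition Prob (L : T -> {set 'I_4}) (v : T) (i : 'I_4) : R :=
  #|[set c | proper_col L c & c v == i]|%:R / #|[set c | proper_col L c]|%:R.

End Defs.

Definition lambda (R : realFieldType) : R := 9996%:R / 10000%:R.

(* Main.v *)
Require Import Defs.
From mathcomp Require Import boolp reals normedtype derive realfun Rstruct.
From mathcomp Require Import all_boot all_order all_algebra ring lra.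
Set Implicit Arguments. Unset Strict Implicit. Unset Printing Implicit Defensive.
Import Order.TTheory GRing.Theory Num.Theory.
Import numFieldNormedType.Exports.
Local Open Scope ring_scope.

(**
  The exact marginals satisfy the recursion that defines [P], so both are obtained by applying
  the same maps to different values at the leaves of the recursion tree, and it is enough to
  show that one application contracts.  Below the root every queried vertex has
  [|L v| >= deg v + 2], which keeps all values in [0, 1/2].  Errors are measured in the metric
  [|dx| / Phi x] with [Phi x = x * (kappa - x)], where [kappa] is slightly above [1/2]: two values
  are [eps]-close if a path in [0, 1/2] with [|X'| <= eps * Phi X] joins them.  The image of such
  paths under the recursion is again a path, so only a pointwise derivative estimate is needed.

  At a vertex of degree 2, write [f] for the law of the first neighbour (itself expanded one
  level) and [y] for the values of the second one.  As the [f j] sum to 1, their derivatives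
  partly cancel.  What remains is a sum over the colors [j] of terms that depend only on [f j]
  and [y j]; maximizing each of them over [y j] leaves an inequality affine in the value of [f]
  at the queried color, so it is checked at the two ends of the range of that value.

  The mean value theorem needs real numbers.  Over an arbitrary ordered field all the quantities
  involved are images of rational numbers.
*)

Section RealFieldFacts.
Variable R : realFieldType.
Implicit Types a b r s x y : R.

Lemma ler_normD_le a b x y : `|x| <= a -> `|y| <= b -> `|x + y| <= a + b.
Proof. by move=> xa yb; apply: le_trans (ler_normD _ _) (lerD xa yb). Qed.

Lemma ler_normB_le a b x y : `|x| <= a -> `|y| <= b -> `|x - y| <= a + b.
Proof. by move=> xa yb; apply: le_trans (ler_normB _ _) (lerD xa yb). Qed.

Lemma ler_normM_le a b x y : `|x| <= a -> `|y| <= b -> `|x * y| <= a * b.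
Proof. by move=> xa yb; rewrite normrM ler_pM. Qed.

Lemma ler_norm_sum_le (I : finType) (P : pred I) (F G : I -> R) :
  (forall j, P j -> `|F j| <= G j) -> `|\sum_(j | P j) F j| <= \sum_(j | P j) G j.
Proof. by move=> FG; apply: le_trans (ler_norm_sum _ _ _) _; exact: ler_sum. Qed.

(* The second hypothesis says that [q] is a polynomial of degree at most 2, and [a] its
   coefficient of degree 2. *)
Lemma quadratic_le0_between (q : R -> R) a x0 x1 x :
  0 <= a -> (forall z, q z = a * z ^+ 2 + (q 1 - q 0 - a) * z + q 0) ->
  x0 <= x <= x1 -> q x0 <= 0 -> q x1 <= 0 -> q x <= 0.
Proof.
move=> a_ge0 qE /andP[x0x xx1] at0 at1.
have [x01|x10] := ltP x0 x1; last by have -> : x = x0 by lra.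
rewrite -(@pmulr_rle0 _ (x1 - x0)) ?subr_gt0 //.
rewrite [leLHS](_ : _ = (x1 - x) * q x0 + (x - x0) * q x1
    - a * (x1 - x0) * ((x - x0) * (x1 - x))); last by rewrite (qE x) (qE x0) (qE x1); ring.
rewrite subr_le0 (@le_trans _ _ 0) //; last by rewrite !mulr_ge0 ?subr_ge0 ?(ltW x01).
by rewrite -[leRHS]addr0 lerD // mulr_ge0_le0 ?subr_ge0.
Qed.

Lemma share_le a a' b b' :
  0 < a -> 0 <= b' -> a <= a' -> b' <= b -> a / (a + b) <= a' / (a' + b').
Proof.
move=> a_gt0 b'_ge0 aa' bb'; have a'_gt0 := lt_le_trans a_gt0 aa'.
have b_ge0 := le_trans b'_ge0 bb'.
rewrite ler_pdivrMr ?ltr_wpDr // mulrAC ler_pdivlMr ?ltr_wpDr //.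
by rewrite !mulrDr [a' * a]mulrC lerD2l ler_pM // ltW.
Qed.

Lemma dist_mul_le a a' b b' r s :
  0 <= a <= 1 -> 0 <= b' <= 1 -> `|a - a'| <= r -> `|b - b'| <= s -> `|a * b - a' * b'| <= r + s.
Proof.
move=> /andP[a_ge0 a_le1] /andP[b'_ge0 b'_le1] aa' bb'.
have -> : a * b - a' * b' = b' * (a - a') + a * (b - b') by ring.
have norm_a : `|a| <= 1 by rewrite ger0_norm.
have norm_b' : `|b'| <= 1 by rewrite ger0_norm.
by rewrite -[r]mul1r -[s]mul1r; apply: ler_normD_le; exact: ler_normM_le.
Qed.

Lemma dist_prod_le n (a a' : 'I_n -> R) r :
  (forall k, 0 <= a k <= 1) -> (forall k, 0 <= a' k <= 1) -> (forall k, `|a k - a' k| <= r) ->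
  `|\prod_(k < n) a k - \prod_(k < n) a' k| <= n%:R * r.
Proof.
elim: n a a' => [|n IHn] a a' a01 a'01 aa'; first by rewrite !big_ord0 subrr normr0 mul0r.
rewrite !big_ord_recr /= -natr1 mulrDl mul1r; apply: dist_mul_le => //; last exact: IHn.
by rewrite prodr_ge0 ?prodr_ile1 // => k _; case/andP: (a01 (widen_ord (leqnSn n) k)).
Qed.

End RealFieldFacts.

(** * The inequality behind the contraction *)

Section Weight.
Variable R : realFieldType.
Implicit Types x s : R.

Definition sigma : R := 19 / 27.

(* Slightly above [1/2], so that [Phi] does not vanish at the attainable value [1/2], and such
   that [1 - kappa] is a rational square. *)
Definition kappa : R := 1 - sigma ^+ 2.

Definition Phi x : R := x * (kappa - x).
Definition psi x : R := Phi x / (1 - x).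
Definition psi_max : R := (1 - sigma) ^+ 2.

Lemma Phi_ge0 x : 0 <= x <= 1/2 -> 0 <= Phi x.
Proof. by move=> /andP[x0 x1]; rewrite mulr_ge0 // /kappa /sigma; lra. Qed.

Lemma Phi_le1 x : Phi x <= 1.
Proof. by have := sqr_ge0 (x - kappa / 2); rewrite /Phi /kappa /sigma; nra. Qed.

Lemma psi_ge0 x : 0 <= x <= 1/2 -> 0 <= psi x.
Proof. by move=> x_rng; rewrite divr_ge0 ?Phi_ge0 //; lra. Qed.

Lemma psi_le_max x : 0 <= x <= 1/2 -> psi x <= psi_max.
Proof.
move=> x_rng; rewrite ler_pdivrMr; last by lra.
rewrite -subr_ge0 (_ : _ - _ = (1 - x - sigma) ^+ 2) ?sqr_ge0 //.
by rewrite /psi_max /Phi /kappa; ring.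
Qed.

(* [psi x = 1 + sigma ^ 2 - c - sigma ^ 2 / c] at [c = 1 - x]; this is its tangent at [c = s]. *)
Definition psi_tangent s c : R := 1 + sigma ^+ 2 - c - sigma ^+ 2 * (2 * s - c) / s ^+ 2.

Lemma psi_le_tangent s x : 0 < s -> 0 <= x <= 1/2 -> psi x <= psi_tangent s (1 - x).
Proof.
move=> s_gt0 x_rng; have c_gt0 : 0 < 1 - x by lra.
rewrite -subr_ge0.
rewrite (_ : _ - _ = sigma ^+ 2 * (1 - x - s) ^+ 2 / (s ^+ 2 * (1 - x))); last first.
  by rewrite /psi_tangent /psi /Phi /kappa; field; rewrite !gt_eqF.
have c_ge0 := ltW c_gt0.
by apply: divr_ge0; apply: mulr_ge0; rewrite ?sqr_ge0.
Qed.

End Weight.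

Section FluxBound.
Variable R : realFieldType.
Implicit Types th c d f g p s w x y : R.
Local Notation lam := (lambda R).
Local Notation sig := (sigma R).

(* [p * c + (1 - c) * (c - sigma ^ 2) - lambda * kappa * c] is maximal at [c = peak p]. *)
Definition peak p : R := (p + 2 - kappa R * (1 + lam)) / 2.

(* Bounds the difference of the two sides of [flux_bound_le] at [f = f i], [p = psi (y i)] and
   [c = 1 - y i], once the other colors have been summed out. *)
Definition excess th f p c : R :=
  (2 + f) * (peak p ^+ 2 - sig ^+ 2) + 6 * th * f * peak p + th ^+ 2 * (1/3 + 2 * f)
  + lam * sig ^+ 2 * (1 - f) * c.

Lemma excess_mono th f p p' c c' : 0 <= th -> 0 <= f <= 1 -> 0 <= p -> p <= p' -> c <= c' ->
  excess th f p c <= excess th f p' c'.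
Proof.
move=> th_ge0 /andP[f_ge0 f_le1] p_ge0 pp' cc'.
have peak_ge0 : 0 <= peak p by rewrite /peak /kappa /sigma /lambda; lra.
have peak_le : peak p <= peak p' by rewrite /peak; lra.
rewrite /excess; apply: lerD; [apply: lerD => //; apply: lerD|].
- by apply: ler_wpM2l; [lra|rewrite lerD2r lerXn2r ?nnegrE // (le_trans peak_ge0)].
- by apply: ler_wpM2l => //; rewrite !mulr_ge0.
- apply: ler_wpM2l => //; apply: mulr_ge0; last lra.
  by rewrite mulr_ge0 ?sqr_ge0 // /lambda; lra.
Qed.

(* [psi] is bounded by [psi_max] for [c <= h] and by its tangent at [s] for [c >= h]. *)
Lemma excess_le0_by_tangent s h th f x :
  0 <= th -> 0 <= f <= 1 -> 0 <= x <= 1/2 -> 0 < s ->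
  0 <= psi_tangent s h <= psi_max R -> excess th f (psi_max R) h <= 0 ->
  excess th f (psi_tangent s 1) 1 <= 0 ->
  excess th f (psi x) (1 - x) <= 0.
Proof.
move=> th_ge0 f01 x_rng s_gt0 /andP[tangent_h0 tangent_h] at_h at_1.
have psi0 := psi_ge0 x_rng.
have [le_h|/ltW ge_h] := leP (1 - x) h.
  by apply: le_trans at_h; apply: excess_mono => //; exact: psi_le_max.
have tangent0 : 0 <= psi_tangent s (1 - x) := le_trans psi0 (psi_le_tangent s_gt0 x_rng).
apply: (@le_trans _ _ (excess th f (psi_tangent s (1 - x)) (1 - x))).
  by apply: excess_mono => //; exact: psi_le_tangent.
pose q c := excess th f (psi_tangent s c) c.
apply: (@quadratic_le0_between _ q ((2 + f) * (1 - sig ^+ 2 / s ^+ 2) ^+ 2 / 4) h 1) => //.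
- by rewrite divr_ge0 // mulr_ge0 ?sqr_ge0; lra.
- by move=> z; rewrite /q /excess /peak /psi_tangent; field; rewrite gt_eqF.
- by rewrite ge_h; lra.
- by apply: le_trans at_h; apply: excess_mono; rewrite ?tangent_h0.
Qed.

(* Either the first neighbour has at most one further neighbour, or it has two.  Its law takes
   the value [f] at the queried color, and [th * eps] bounds the logarithmic derivatives of the
   weights of this law. *)
Definition regime th f : Prop := th = psi_max R /\ f <= 1/2 \/ th = 2 * psi_max R /\ 1/13 <= f.

Lemma regime_ge0 th f : regime th f -> 0 <= th.
Proof. by move=> [[-> _]|[-> _]]; rewrite /psi_max /sigma; lra. Qed.

Lemma excess_le0_between th f0 f1 f p c :
  f0 <= f <= f1 -> excess th f0 p c <= 0 -> excess th f1 p c <= 0 -> excess th f p c <= 0.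
Proof.
apply: (@quadratic_le0_between _ (fun z => excess th z p c) 0) => // z.
by rewrite /excess; ring.
Qed.

(* The tangency points are close to the maximizers of [excess] in [1 - x], and the tangents reach
   [psi_max] near the thresholds. *)
Lemma excess_le0 th f x : regime th f -> 0 <= f <= 4/7 -> 0 <= x <= 1/2 ->
  excess th f (psi x) (1 - x) <= 0.
Proof.
move=> [[-> f_le]|[-> f_ge]] f_rng x_rng.
- apply: (@excess_le0_between _ 0 (1/2)); first lra.
  + apply: (@excess_le0_by_tangent (974/1000) (8171/10000)) => //;
      rewrite /excess /peak /psi_tangent /psi_max /kappa /sigma /lambda; lra.
  + apply: (@excess_le0_by_tangent (774/1000) (738/1000)) => //;
      rewrite /excess /peak /psi_tangent /psi_max /kappa /sigma /lambda; lra.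
- apply: (@excess_le0_between _ (1/13) (4/7)); first lra.
  + apply: (@excess_le0_by_tangent (916/1000) (796/1000)) => //;
      rewrite /excess /peak /psi_tangent /psi_max /kappa /sigma /lambda; lra.
  + apply: (@excess_le0_by_tangent (754/1000) (728/1000)) => //;
      rewrite /excess /peak /psi_tangent /psi_max /kappa /sigma /lambda; lra.
Qed.

(* The maximum [g / w] of the parabola lies to the right of the hinge [g], so the absolute value
   may be dropped. *)
Lemma hinged_quadratic_le w g d b : 0 < w <= 1 -> 0 <= g -> 0 <= b ->
  - w * d ^+ 2 + 2 * g * d + 2 * b * `|d - g| <= (g + b) ^+ 2 / w - 2 * b * g.
Proof.
move=> /andP[w_gt0 w_le1] g_ge0 b_ge0; rewrite lerBrDr ler_pdivlMr //.
have [gd|/ltW dg] := leP g d.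
  rewrite ger0_norm ?subr_ge0 // -subr_ge0.
  by rewrite [leRHS](_ : _ = (w * d - (g + b)) ^+ 2) ?sqr_ge0 //; ring.
rewrite ler0_norm ?subr_le0 // -subr_ge0.
rewrite [leRHS](_ : _ = (w * d - (g - b)) ^+ 2 + 4 * (g * b) * (1 - w)); last by ring.
by rewrite addr_ge0 ?sqr_ge0 // !mulr_ge0 ?subr_ge0.
Qed.

Lemma inv_le_secant w : 3/7 <= w <= 1 -> w^-1 <= (10/7 - w) * (7/3).
Proof.
move=> /andP[w_ge w_le1]; have w_gt0 : 0 < w by lra.
rewrite -(ler_pM2r w_gt0) mulVf ?gt_eqF //.
have := mulr_ge0 (_ : 0 <= w - 3/7) (_ : 0 <= 1 - w); rewrite !subr_ge0 => /(_ w_ge w_le1); lra.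
Qed.

(* [peak p + th * f] is where the smooth part is maximal for [w = 1]: this puts the hinge of
   [hinged_quadratic_le] at [g = th * f]. *)
Lemma color_term_le th f w p y : 0 <= th -> 0 <= f <= 1 -> 3/7 <= w <= 1 ->
  w * (Phi y + (1 - y) * p - lam * kappa R * (1 - y))
    + th * (2 * f * (1 - y) + (1 - f) / 2 * `|1 - y - (peak p + th * f)|)
  <= w * (peak p ^+ 2 - sig ^+ 2) + 2 * th * f * peak p
    + th ^+ 2 * ((1 + 3 * f) ^+ 2 / 16 * ((10/7 - w) * (7/3)) - f * (1 - f) / 2).
Proof.
move=> th_ge0 /andP[f_ge0 f_le1] w_rng; have [w_ge w_le1] := andP w_rng.
pose d := 1 - y - peak p; pose b := th * (1 - f) / 4.
have b_ge0 : 0 <= b by rewrite divr_ge0 // mulr_ge0 // subr_ge0.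
have w_gt0 : 0 < w by lra.
have w_unit : 0 < w <= 1 by rewrite w_gt0.
have := hinged_quadratic_le d w_unit (mulr_ge0 th_ge0 f_ge0) b_ge0.
have := ler_wpM2l (sqr_ge0 (th * f + b)) (inv_le_secant w_rng).
rewrite (_ : 1 - y - _ = d - th * f); last by rewrite /d; ring.
move: `|d - th * f| => hinge secant hinged.
have {hinged secant} := le_trans hinged (lerD secant (lexx _)).
rewrite -(lerD2l (w * (peak p ^+ 2 - sig ^+ 2) + 2 * th * f * peak p)).
by congr (_ <= _); rewrite /b /d /Phi /peak /kappa; field.
Qed.

Lemma hinge_total_le f : 0 <= f <= 4/7 ->
  (1 + 3 * f) ^+ 2 * (16/7 - f) * (7/48) - 3 * f * (1 - f) / 2 <= 1/3 + 2 * f.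
Proof.
move=> /andP[f_ge0 f_le]; rewrite -subr_ge0.
rewrite [leRHS](_ : _ = f * (1/336 + (4/7 - f) * (23/8 - 21/16 * f))); last by field.
by rewrite mulr_ge0 // addr_ge0 ?mulr_ge0 //; lra.
Qed.

Lemma flux_bound_le th (f y : 'I_4 -> R) i :
  regime th (f i) -> (forall j, 0 <= f j <= 4/7) -> \sum_j f j = 1 ->
  (forall j, 0 <= y j <= 1/2) ->
  \sum_(j | j != i) ((1 - f j) * (Phi (y j) + (1 - y j) * psi (y i))
    + th * (2 * f i * (1 - y j) + (1 - f i) / 2 * `|1 - y j - (peak (psi (y i)) + th * f i)|))
  <= lam * (kappa R * \sum_(j | j != i) (1 - f j) * (1 - y j)
            - sig ^+ 2 * (1 - f i) * (1 - y i)).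
Proof.
move=> th_f f_rng sum_f y_rng; have th_ge0 := regime_ge0 th_f.
have [fi_ge0 fi_le] := andP (f_rng i); have fi01 : 0 <= f i <= 1 by lra.
have others c : \sum_(j | j != i) c = 3 * c :> R.
  by rewrite sumr_const cardC1 card_ord [RHS]mulr_natl.
have sum_others : \sum_(j | j != i) (1 - f j) = 2 + f i.
  by move: sum_f; rewrite sumrB others (bigD1 i) //=; lra.
apply: (@le_trans _ _ (lam * kappa R * \sum_(j | j != i) (1 - f j) * (1 - y j)
    + \sum_(j | j != i) ((1 - f j) * (peak (psi (y i)) ^+ 2 - sig ^+ 2)
      + 2 * th * f i * peak (psi (y i))
      + th ^+ 2 * ((1 + 3 * f i) ^+ 2 / 16 * ((3/7 + f j) * (7/3)) - f i * (1 - f i) / 2)))).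
  rewrite mulr_sumr -big_split /=; apply: ler_sum => j _.
  have w_rng : 3/7 <= 1 - f j <= 1 by have := f_rng j; lra.
  have := color_term_le (psi (y i)) (y j) th_ge0 fi01 w_rng.
  rewrite -(lerD2l (lam * kappa R * ((1 - f j) * (1 - y j)))).
  by congr (_ <= _); field.
set pk := peak _; pose a := th ^+ 2 * (1 + 3 * f i) ^+ 2 * (7/48).
rewrite [X in _ + X <= _](eq_bigr (fun j => (pk ^+ 2 - sig ^+ 2 - a) * (1 - f j)
    + (2 * th * f i * pk + a * (10/7) - th ^+ 2 * (f i * (1 - f i) / 2)))); last first.
  by move=> j _; rewrite /a; field.
rewrite big_split /= -mulr_sumr sum_others others.
have := excess_le0 th_f (f_rng i) (y_rng i).
have := ler_wpM2l (sqr_ge0 th) (hinge_total_le (f_rng i)).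
rewrite /excess /a -/pk; lra.
Qed.

Lemma compl_div_flux_le x y : 0 <= x <= 1/2 -> 0 <= y <= 1/2 ->
  (2 + y) * Phi x + (1 - x) * Phi y <= lam * ((1 - x) * (kappa R * (2 + y) - (1 - x))).
Proof.
move=> /andP[x_ge0 x_le] /andP[y_ge0 y_le]; have x'_ge0 : 0 <= 1/2 - x by lra.
have := mulr_ge0 x_ge0 y_ge0; have := mulr_ge0 x'_ge0 y_ge0.
have := mulr_ge0 (mulr_ge0 x_ge0 y_ge0) x'_ge0; have := mulr_ge0 x'_ge0 (sqr_ge0 y).
have := sqr_ge0 (x - 1/50); rewrite /Phi /kappa /sigma /lambda; nra.
Qed.

End FluxBound.

(** * Laws given by independent avoidance *)

Section Normalize.
Variables (R : realFieldType) (I : finType) (A : {set I}).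
Implicit Types (t : I -> R) (j : I) (lo hi r : R).

Definition normalize t j : R := if j \in A then t j / \sum_(k in A) t k else 0.

Lemma eq_normalize t t' : {in A, t =1 t'} -> normalize t =1 normalize t'.
Proof. by move=> tt' j; rewrite /normalize; case: ifP => // jA; rewrite tt' // (eq_bigr _ tt'). Qed.

Lemma sumr_in_gt0 t j : j \in A -> {in A, forall k, 0 < t k} -> 0 < \sum_(k in A) t k.
Proof.
move=> jA t_gt0; rewrite (big_setD1 j jA) ltr_wpDr ?t_gt0 // sumr_ge0 // => k /setD1P[_ /t_gt0].
exact: ltW.
Qed.

Lemma normalize_ge0 t j : {in A, forall k, 0 < t k} -> 0 <= normalize t j.
Proof.
move=> t_gt0; rewrite /normalize; case: ifP => // jA.
by rewrite divr_ge0 // ltW ?t_gt0 // (sumr_in_gt0 jA).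
Qed.

Lemma sum_normalize t j : j \in A -> {in A, forall k, 0 < t k} -> \sum_k normalize t k = 1.
Proof.
move=> jA t_gt0; rewrite -big_mkcond -mulr_suml divff // gt_eqF //; exact: sumr_in_gt0 jA _.
Qed.

Lemma normalize_bounds t lo hi j : 0 < lo -> {in A, forall k, lo <= t k <= hi} -> j \in A ->
  lo / (lo + #|A|.-1%:R * hi) <= normalize t j <= hi / (hi + #|A|.-1%:R * lo).
Proof.
move=> lo_gt0 t_rng jA; rewrite /normalize jA (big_setD1 j jA) /=.
have [t_ge t_le] := andP (t_rng j jA); have t_gt0 := lt_le_trans lo_gt0 t_ge.
have lo_ge0 := ltW lo_gt0; have hi_ge0 := le_trans (ltW t_gt0) t_le.
have rest_const c : #|A|.-1%:R * c = \sum_(k in A :\ j) c :> R.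
  by rewrite sumr_const -[RHS]mulr_natl (cardsD1 j A) jA.
rewrite !rest_const !share_le ?sumr_ge0 //.
- by apply: ler_sum => k /setD1P[_ /t_rng/andP[]].
- by move=> k /setD1P[_ /t_rng/andP[/(le_trans lo_ge0)]].
- by apply: ler_sum => k /setD1P[_ /t_rng/andP[]].
Qed.

Lemma normalize_lipschitz t t' lo r j : 0 < lo -> 0 <= r ->
  {in A, forall k, lo <= t k} -> {in A, forall k, lo <= t' k} ->
  {in A, forall k, `|t k - t' k| <= r} ->
  `|normalize t j - normalize t' j| <= #|A|.+1%:R * r / lo.
Proof.
move=> lo_gt0 r_ge0 t_ge t'_ge tt'; rewrite /normalize; case: ifP => jA; last first.
  by rewrite subrr normr0 divr_ge0 ?mulr_ge0 // ltW.
set Z := \sum_(k in A) t k; set Z' := \sum_(k in A) t' k.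
have t'_gt0 : {in A, forall k, 0 < t' k} by move=> k /t'_ge; exact: lt_le_trans.
have Z'_gt0 : 0 < Z' := sumr_in_gt0 jA t'_gt0.
have Z_ge : lo <= Z.
  rewrite /Z (big_setD1 j jA) ler_wpDr ?t_ge // sumr_ge0 // => k /setD1P[_ /t_ge].
  by apply: le_trans; exact: ltW.
have Z_gt0 := lt_le_trans lo_gt0 Z_ge.
have dist_Z : `|Z - Z'| <= #|A|%:R * r.
  by rewrite -sumrB mulr_natl -sumr_const; exact: ler_norm_sum_le.
have -> : t j / Z - t' j / Z' = ((t j - t' j) - normalize t' j * (Z - Z')) / Z.
  by rewrite /normalize jA -/Z'; field; rewrite !gt_eqF.
have quot01 : `|normalize t' j| <= 1.
  rewrite ger0_norm ?normalize_ge0 // -(sum_normalize jA t'_gt0) (bigD1 j) //= lerDl.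
  by rewrite sumr_ge0 // => k _; exact: normalize_ge0.
rewrite normrM normfV (gtr0_norm Z_gt0) ler_pM ?invr_ge0 ?(ltW Z_gt0) ?lef_pV2 //.
rewrite -nat1r mulrDl mul1r; apply: ler_normB_le; first exact: tt'.
by rewrite -[leRHS]mul1r ler_normM_le.
Qed.

End Normalize.

Section Law.
Variables (R : realFieldType) (I : finType) (n : nat).
Implicit Types (A : {set I}) (x : 'I_n -> I -> R) (j : I) (u : R).

Definition avoid x j : R := \prod_(k < n) (1 - x k j).

Definition law A x : I -> R := normalize A (avoid x).

Lemma eq_law A x x' : (forall k j, x k j = x' k j) -> law A x =1 law A x'.
Proof. by move=> xx'; apply: eq_normalize => j _; apply: eq_bigr => k _; rewrite xx'. Qed.

Lemma avoid_bounds u x j : u <= 1 -> (forall k, 0 <= x k j <= u) -> (1 - u) ^+ n <= avoid x j <= 1.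
Proof.
move=> u_le1 x_rng; apply/andP; split.
  rewrite -[n in _ ^+ n]card_ord -prodr_const; apply: ler_prod => k _.
  by rewrite subr_ge0 u_le1 lerD2l lerN2; case/andP: (x_rng k).
apply: prodr_ile1 => k _; have /andP[x_ge0 x_le] := x_rng k.
by rewrite subr_ge0 (le_trans x_le) //= gerBl.
Qed.

Lemma avoid_lipschitz u x x' j r : u <= 1 ->
  (forall k, 0 <= x k j <= u) -> (forall k, 0 <= x' k j <= u) ->
  (forall k, `|x k j - x' k j| <= r) -> `|avoid x j - avoid x' j| <= n%:R * r.
Proof.
move=> u_le1 x_rng x'_rng xx'; apply: dist_prod_le => k.
- by have := x_rng k; lra.
- by have := x'_rng k; lra.
- by rewrite opprB addrC addrA subrK distrC.
Qed.

Lemma law_lipschitz A u x x' j r : 0 <= r -> u < 1 ->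
  (forall k j, 0 <= x k j <= u) -> (forall k j, 0 <= x' k j <= u) ->
  (forall k j, `|x k j - x' k j| <= r) ->
  `|law A x j - law A x' j| <= #|A|.+1%:R * (n%:R * r) / (1 - u) ^+ n.
Proof.
move=> r_ge0 u_lt1 x_rng x'_rng xx'; have u_le1 := ltW u_lt1.
apply: normalize_lipschitz => [|||j' _|j' _].
- by rewrite exprn_gt0 ?subr_gt0.
- exact: mulr_ge0.
- by move=> j' _; case/andP: (@avoid_bounds u x j' u_le1 (x_rng^~ j')).
- by case/andP: (@avoid_bounds u x' j' u_le1 (x'_rng^~ j')).
- by apply: (@avoid_lipschitz u).
Qed.

Section SmallArity.
Variables (A : {set I}) (x : 'I_n -> I -> R).
Hypotheses (arity : (n + 2 <= #|A| <= 4)%N) (x_rng : forall k j, 0 <= x k j <= 1/2).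

Lemma law_arity_le2 : (n <= 2)%N.
Proof. by have /andP[nA A4] := arity; rewrite -(leq_add2r 2) (leq_trans nA). Qed.

Let avoid_rng j : (1/2) ^+ n <= avoid x j <= 1.
Proof.
have := @avoid_bounds (1/2) x j _ (x_rng^~ j).
by rewrite (_ : 1 - 1/2 = 1/2); [apply; lra|field].
Qed.

Lemma avoid_gt0 j : 0 < avoid x j.
Proof. by have /andP[/(lt_le_trans _)-> //] := avoid_rng j; rewrite exprn_gt0 ?divr_gt0. Qed.

Lemma law_ge0 j : 0 <= law A x j.
Proof. by apply: normalize_ge0 => k _; exact: avoid_gt0. Qed.

Lemma sum_law : \sum_j law A x j = 1.
Proof.
have /card_gt0P[j jA] : (0 < #|A|)%N by have /andP[nA _] := arity; rewrite (leq_trans _ nA) ?addn2.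
by apply: (sum_normalize jA) => k _; exact: avoid_gt0.
Qed.

Lemma law_ge j : j \in A -> 1/13 <= law A x j.
Proof.
move=> jA; have half_gt0 : 0 < (1/2 : R) ^+ n by rewrite exprn_gt0 ?divr_gt0.
have /andP[law_lo _] := normalize_bounds half_gt0 (fun k _ => avoid_rng k) jA.
apply: le_trans law_lo; rewrite (_ : 1/13 = 1/4 / (1/4 + 3)); last by field.
have /andP[_ A4] := arity; apply: share_le; rewrite ?divr_gt0 ?mulr_ge0 ?mulr1 //.
- by move: law_arity_le2; case: n => [|[|[|//]]] _; rewrite ?expr0 ?expr1 ?expr2; lra.
- by rewrite ler_nat -ltnS; case: #|A| A4.
Qed.

Lemma law_le j : law A x j <= if n == 2%N then 4/7 else 1/2.
Proof.
have bound_ge0 : 0 <= if n == 2%N then 4/7 else 1/2 :> R by case: ifP => _; rewrite divr_ge0.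
have [jA|jA] := boolP (j \in A); last by rewrite /law /normalize (negbTE jA).
have half_gt0 : 0 < (1/2 : R) ^+ n by rewrite exprn_gt0 ?divr_gt0.
have /andP[_ law_hi] := normalize_bounds half_gt0 (fun k _ => avoid_rng k) jA.
apply: le_trans law_hi _.
have others : n.+1%:R <= #|A|.-1%:R :> R.
  by have /andP[nA _] := arity; rewrite ler_nat -ltnS (leq_trans _ (leqSpred _)) // -addn2.
rewrite [leRHS](_ : _ = 1 / (1 + n.+1%:R * (1/2) ^+ n)); last first.
  by move: law_arity_le2; case: n => [|[|[|//]]] _ /=; rewrite ?expr0 ?expr1 ?expr2; field.
apply: share_le => //; first by rewrite mulr_ge0 // ltW.
by rewrite ler_pM2r.
Qed.

End SmallArity.
End Law.

Section Pair.
Variables (R : realFieldType) (I : finType).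
Implicit Types (f y : I -> R).

Definition pair_of f y (k : 'I_2) : I -> R := if k == ord0 then f else y.

Lemma avoid_pair f y j : avoid (pair_of f y) j = (1 - f j) * (1 - y j).
Proof. by rewrite /avoid !big_ord_recl big_ord0 mulr1. Qed.

End Pair.

Section LawDrift.
Variables (R : realFieldType) (I : finType) (f q c : I -> R) (i : I) (tau m : R).
Hypotheses (f_ge0 : forall j, 0 <= f j) (sum_f : \sum_j f j = 1).
Hypotheses (q_le : forall j, `|q j| <= tau) (c_ge0 : forall j, 0 <= c j).

Let Q := \sum_(k | k != i) f k * q k.

Let mass_others : \sum_(k | k != i) f k = 1 - f i.
Proof. by move: sum_f; rewrite (bigD1 i) //=; lra. Qed.

Let norm_f j : `|f j| = f j.
Proof. by rewrite ger0_norm. Qed.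

Let gap_le j k : `|f k * q j - f k * q k| <= f k * (2 * tau).
Proof.
by rewrite -mulrBr; apply: ler_normM_le; rewrite ?norm_f ?mulr_natl ?mulr2n ?ler_normB_le.
Qed.

Let gap_to_others j : `|(1 - f i) * q j - Q| <= (1 - f i) * (2 * tau).
Proof.
by rewrite -mass_others !mulr_suml -sumrB; apply: ler_norm_sum_le => k _; exact: gap_le.
Qed.

Let gap_to_others_in j : j != i -> `|(1 - f i) * q j - Q| <= (1 - f i - f j) * (2 * tau).
Proof.
move=> ji; rewrite /Q -mass_others !(bigD1 (P := fun k => k != i) j ji) /=.
rewrite mulrDl opprD addrACA subrr add0r addrAC subrr add0r !mulr_suml -sumrB.
by apply: ler_norm_sum_le => k _; exact: gap_le.
Qed.

(* A law of the form [f = normalize t] whose weights have logarithmic derivatives [q] moves with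
   velocity [f j * (q j - mean of q)].  The constant [m] is free since velocities sum to 0. *)
Lemma law_drift_le (qbar := \sum_j f j * q j) :
  `|\sum_(j | j != i) c j * ((1 - f i) * (f j * (q j - qbar)) - (1 - f j) * (f i * (q i - qbar)))|
  <= tau * (1 - f i) * \sum_(j | j != i) (2 * f i * c j + (1 - f i) / 2 * `|c j - m|).
Proof.
have tau_ge0 : 0 <= tau by exact: le_trans (normr_ge0 _) (q_le i).
have rest_ge0 : 0 <= 1 - f i by rewrite -mass_others sumr_ge0.
have qbarE : qbar = f i * q i + Q by rewrite /qbar (bigD1 i).
have velocities_cancel : \sum_(j | j != i) f j * ((1 - f i) * q j - Q) = 0.
  under eq_bigr do rewrite mulrBr mulrCA.
  by rewrite sumrB -mulr_sumr -mulr_suml mass_others subrr.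
rewrite (eq_bigr (fun j => f j * ((1 - f i) * q j - Q) * (c j - m)
    - f i * c j * ((1 - f i) * q i - Q) + m * (f j * ((1 - f i) * q j - Q)))); last first.
  by move=> j _; rewrite qbarE; ring.
rewrite big_split /= -mulr_sumr velocities_cancel mulr0 addr0 mulr_sumr.
apply: ler_norm_sum_le => j ji; rewrite [leRHS](_ : _ =
  (1 - f i) ^+ 2 / 4 * (2 * tau) * `|c j - m| + f i * c j * ((1 - f i) * (2 * tau))); last by field.
apply: ler_normB_le; last first.
  by apply: ler_normM_le (gap_to_others i); rewrite ger0_norm ?mulr_ge0.
rewrite normrM ler_wpM2r // normrM norm_f.
apply: le_trans (ler_wpM2l (f_ge0 j) (gap_to_others_in ji)) _.
rewrite mulrA ler_wpM2r ?mulr_ge0 //.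
by rewrite ler_pdivlMr // -subr_ge0 (_ : _ - _ = (1 - f i - 2 * f j) ^+ 2) ?sqr_ge0 //; ring.
Qed.

End LawDrift.

Section TwoLayerContraction.
Variables (R : realFieldType) (th eps : R) (f y q d : 'I_4 -> R) (i : 'I_4).
Hypotheses (f_rng : forall j, 0 <= f j <= 4/7) (sum_f : \sum_j f j = 1).
Hypotheses (y_rng : forall j, 0 <= y j <= 1/2).

Let a j := (1 - f j) * (1 - y j).
Let qbar := \sum_j f j * q j.
Let rho j := - (f j * (q j - qbar) / (1 - f j)) - d j / (1 - y j).
Let p := normalize [set: 'I_4] a.

Let rest_f_gt0 j : 0 < 1 - f j. Proof. by have := f_rng j; lra. Qed.
Let rest_y_gt0 j : 0 < 1 - y j. Proof. by have := y_rng j; lra. Qed.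

Let a_gt0 j : 0 < a j. Proof. exact: mulr_gt0. Qed.

Let total_gt0 : 0 < \sum_j a j.
Proof. by rewrite (bigD1 i) //= ltr_wpDr ?a_gt0 // sumr_ge0 // => j _; exact: ltW. Qed.

Let pE j : p j = a j / \sum_j a j.
Proof. by rewrite /p /normalize inE; congr (_ / _); apply: eq_bigl => k; rewrite inE. Qed.

Lemma two_layer_range : 0 <= p i <= 1/2.
Proof.
rewrite pE divr_ge0 ?(ltW (a_gt0 _)) ?(ltW total_gt0) //= ler_pdivrMr // (bigD1 i) //=.
have [f_ge0 f_le] := andP (f_rng i); have [y_ge0 y_le] := andP (y_rng i).
have a_le : a i <= 1 - f i by rewrite ler_piMr ?gerBl // ltW.
suff : 1 - f i <= \sum_(j | j != i) a j by lra.
apply: (@le_trans _ _ (\sum_(j | j != i) (1 - f j) / 2)); last first.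
  by apply: ler_sum => j _; rewrite ler_wpM2l ?(ltW (rest_f_gt0 j)) //; have := y_rng j; lra.
rewrite -mulr_suml sumrB sumr_const cardC1 card_ord.
by move: sum_f; rewrite (bigD1 i) //=; lra.
Qed.

Let flux_f := \sum_(j | j != i)
  (1 - y j) * ((1 - f i) * (f j * (q j - qbar)) - (1 - f j) * (f i * (q i - qbar))).
Let flux_y := \sum_(j | j != i) (1 - f j) * ((1 - y i) * d j - (1 - y j) * d i).

Let driftE : p i * (rho i - \sum_j p j * rho j) =
  ((1 - y i) * flux_f + (1 - f i) * flux_y) / (\sum_j a j) ^+ 2.
Proof.
have total_neq0 : \sum_j a j != 0 by rewrite gt_eqF.
have -> : \sum_j p j * rho j = (\sum_j a j * rho j) / \sum_j a j.
  by rewrite mulr_suml; apply: eq_bigr => j _; rewrite pE mulrAC.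
rewrite pE [LHS](_ : _ = (a i * rho i * (\sum_j a j) - a i * \sum_j a j * rho j)
   / (\sum_j a j) ^+ 2); last by field.
congr (_ / _); rewrite (bigD1 i) //= [in X in _ - X](bigD1 i) //=.
rewrite [LHS](_ : _ = a i * rho i * \sum_(j | j != i) a j - a i * \sum_(j | j != i) a j * rho j);
  last by ring.
rewrite !mulr_sumr -sumrB -big_split /=.
apply: eq_bigr => j _; rewrite /rho /a; field.
by rewrite !gt_eqF.
Qed.

Lemma two_layer_contraction : 0 <= eps -> regime th (f i) ->
  (forall j, `|d j| <= eps * Phi (y j)) -> (forall j, `|q j| <= th * eps) ->
  `|p i * (rho i - \sum_j p j * rho j)| <= lambda R * eps * Phi (p i).
Proof.
move=> eps_ge0 th_f d_le q_le.
have total2_gt0 : 0 < (\sum_j a j) ^+ 2 by rewrite exprn_gt0.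
rewrite driftE normrM normfV (gtr0_norm total2_gt0) ler_pdivrMr //.
have flux_f_le : `|flux_f| <= th * eps * (1 - f i) * \sum_(j | j != i)
    (2 * f i * (1 - y j) + (1 - f i) / 2 * `|1 - y j - (peak (psi (y i)) + th * f i)|).
  by apply: law_drift_le => // j; [case/andP: (f_rng j)|exact: ltW].
have flux_y_le : `|flux_y| <= eps * (1 - y i) *
    \sum_(j | j != i) (1 - f j) * (Phi (y j) + (1 - y j) * psi (y i)).
  rewrite mulr_sumr; apply: ler_norm_sum_le => j _; rewrite [leRHS]mulrCA.
  apply: ler_normM_le; first by rewrite gtr0_norm.
  rewrite [leRHS](_ : _ = (1 - y i) * (eps * Phi (y j)) + (1 - y j) * (eps * Phi (y i))).
    by apply: ler_normB_le; apply: ler_normM_le => //; rewrite gtr0_norm.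
  by rewrite /psi; field; rewrite gt_eqF.
have Phi_p : Phi (p i) * (\sum_j a j) ^+ 2 = a i * (kappa R * (\sum_(j | j != i) a j)
   - sigma R ^+ 2 * a i).
  rewrite /Phi pE [in RHS](_ : \sum_(j | j != i) a j = (\sum_j a j) - a i).
    by rewrite /kappa; field; rewrite gt_eqF.
  by rewrite [in RHS](bigD1 i) //= [RHS]addrC addKr.
have common_ge0 : 0 <= eps * ((1 - f i) * (1 - y i)) by rewrite mulr_ge0 // ltW // a_gt0.
have contraction := ler_wpM2l common_ge0 (flux_bound_le th_f f_rng sum_f y_rng).
rewrite -[leRHS]mulrA Phi_p.
have flux_le := ler_normD_le (ler_normM_le (lexx `|1 - y i|) flux_f_le)
  (ler_normM_le (lexx `|1 - f i|) flux_y_le).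
apply: le_trans flux_le _.
move: contraction; rewrite !gtr0_norm // big_split /= -mulr_sumr.
by congr (_ <= _); rewrite /a; ring.
Qed.

End TwoLayerContraction.

Lemma full_colors (A : {set 'I_4}) : (4 <= #|A|)%N -> A = setT.
Proof. by move=> A4; apply/eqP; rewrite eqEcard subsetT cardsT card_ord. Qed.

Lemma law_dist_le (R : realFieldType) n m (A : {set 'I_4}) (x x' : 'I_n -> 'I_4 -> R) i u r :
  (n <= m)%N -> 0 <= u < 1 -> 0 <= r ->
  (forall k j, 0 <= x k j <= u) -> (forall k j, 0 <= x' k j <= u) ->
  (forall k j, `|x k j - x' k j| <= r) ->
  `|law A x i - law A x' i| <= 5 * (m%:R * r) / (1 - u) ^+ m.
Proof.
move=> nm /andP[u_ge0 u_lt1] r_ge0 x_rng x'_rng xx'.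
have rest_gt0 k : 0 < (1 - u) ^+ k by rewrite exprn_gt0 // subr_gt0.
have card_le : (#|A|.+1 <= 5)%N by rewrite ltnS (leq_trans (max_card _)) ?card_ord.
apply: le_trans (law_lipschitz A i r_ge0 u_lt1 x_rng x'_rng xx') _.
apply: ler_pM; rewrite ?invr_ge0 ?(ltW (rest_gt0 _)) ?mulr_ge0 //.
  by rewrite ler_pM ?ler_nat ?mulr_ge0 // ler_wpM2r ?ler_nat.
by rewrite lef_pV2 ?posrE // ler_wiXn2l ?subr_ge0 ?gerBl // ltW.
Qed.

Section LogRate.
Variable R : realFieldType.

Definition log_rate n : R := if n == 2%N then 2 * psi_max R else psi_max R.

Lemma log_rate_ge n : (n <= 2)%N -> n%:R * psi_max R <= log_rate n.
Proof.
have psi_max_ge0 : 0 <= psi_max R := sqr_ge0 _.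
by case: n => [|[|[|//]]] _; rewrite /log_rate /= ?mul0r ?mul1r.
Qed.

Lemma law_regime n (A : {set 'I_4}) (x : 'I_n -> 'I_4 -> R) i :
  (n + 2 <= #|A| <= 4)%N -> (forall k j, 0 <= x k j <= 1/2) -> regime (log_rate n) (law A x i).
Proof.
move=> arity x_rng; have := law_le arity x_rng i; rewrite /regime /log_rate.
case: eqP => [n2 _|_ ->]; [right; split=> //|by left].
have A4 : (4 <= #|A|)%N by case/andP: arity; rewrite n2.
by apply: law_ge; rewrite // (full_colors A4) inE.
Qed.

Lemma log_derivative_le n (d x : 'I_n -> R) eps : (n <= 2)%N -> 0 <= eps ->
  (forall k, 0 <= x k <= 1/2) -> (forall k, `|d k| <= eps * Phi (x k)) ->
  `|\sum_(k < n) - (d k / (1 - x k))| <= log_rate n * eps.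
Proof.
move=> n_le2 eps_ge0 x_rng d_le; apply: le_trans (ler_wpM2r eps_ge0 (log_rate_ge n_le2)).
rewrite -[n in n%:R]card_ord -mulrA mulr_natl -sumr_const; apply: ler_norm_sum_le => k _.
have rest_gt0 : 0 < 1 - x k by have := x_rng k; lra.
rewrite normrN normrM normfV (gtr0_norm rest_gt0) ler_pdivrMr //.
apply: le_trans (d_le k) _; rewrite [_ * eps]mulrC -mulrA ler_wpM2l //.
by rewrite -ler_pdivrMr //; exact: psi_le_max.
Qed.

Lemma law_pair_dist_le n (A A1 : {set 'I_4}) (x x' : 'I_n -> 'I_4 -> R) (y y' : 'I_4 -> R) i r :
  (n + 2 <= #|A1| <= 4)%N -> 0 <= r ->
  (forall k j, 0 <= x k j <= 1/2) -> (forall k j, 0 <= x' k j <= 1/2) ->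
  (forall k j, `|x k j - x' k j| <= r) ->
  (forall j, 0 <= y j <= 1/2) -> (forall j, 0 <= y' j <= 1/2) -> (forall j, `|y j - y' j| <= r) ->
  `|law A (pair_of (law A1 x) y) i - law A (pair_of (law A1 x') y') i| <= 2200 * r.
Proof.
move=> arity r_ge0 x_rng x'_rng xx' y_rng y'_rng yy'.
have half01 : 0 <= (1/2 : R) < 1 by lra.
have u01 : 0 <= (4/7 : R) < 1 by lra.
have law_dist j : `|law A1 x j - law A1 x' j| <= 40 * r.
  rewrite [leRHS](_ : _ = 5 * (2 * r) / (1 - 1/2) ^+ 2); last by field.
  exact: law_dist_le (law_arity_le2 arity) half01 r_ge0 x_rng x'_rng xx'.
have pair_rng (z : 'I_n -> 'I_4 -> R) (w : 'I_4 -> R) : (forall k j, 0 <= z k j <= 1/2) ->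
    (forall j, 0 <= w j <= 1/2) -> forall k j, 0 <= pair_of (law A1 z) w k j <= 4/7.
  move=> z_rng w_rng k j; rewrite /pair_of; case: eqP => _; last by have := w_rng j; lra.
  by rewrite law_ge0 // (le_trans (law_le arity z_rng j)) //; case: ifP => _; lra.
have r40_ge0 : 0 <= 40 * r by rewrite mulr_ge0.
have pair_dist k j : `|pair_of (law A1 x) y k j - pair_of (law A1 x') y' k j| <= 40 * r.
  by rewrite /pair_of; case: eqP => // _; apply: le_trans (yy' j) _; lra.
apply: le_trans (law_dist_le A i (leqnn 2) u01 r40_ge0 (pair_rng _ _ x_rng y_rng)
  (pair_rng _ _ x'_rng y'_rng) pair_dist) _.
by rewrite [leLHS](_ : _ = (400 * 49 / 9) * r); [rewrite ler_wpM2r //; lra|field].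
Qed.

End LogRate.

(** * Closeness along paths *)

Section Derivatives.
Variable R : realType.
Implicit Types (f g : R -> R) (t a b : R).

Definition der f t a : Prop := is_derive t (1 : R) f a.

Lemma der_compl f t a : der f t a -> der (fun s => 1 - f s) t (- a).
Proof. by move=> fa; rewrite -sub0r; exact: is_deriveB. Qed.

Lemma derM f g t a b :
  der f t a -> der g t b -> der (fun s => f s * g s) t (a * g t + f t * b).
Proof.
by move=> fa gb; apply: (is_derive_eq (is_deriveM fa gb)); rewrite addrC [a * _]mulrC.
Qed.

Lemma der_div f g t a b : g t != 0 -> der f t a -> der g t b ->
  der (fun s => f s / g s) t ((a * g t - f t * b) / g t ^+ 2).
Proof.
move=> gt_neq0 fa gb; have gV := is_deriveV gt_neq0 gb.
by apply: (is_derive_eq (derM fa gV)); rewrite /GRing.scale /=; field.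
Qed.

Lemma der_sum (I : Type) (r : seq I) (P : pred I) (h : I -> R -> R) (d : I -> R) t :
  (forall i, P i -> der (h i) t (d i)) ->
  der (fun s => \sum_(i <- r | P i) h i s) t (\sum_(i <- r | P i) d i).
Proof.
move=> h_der; elim: r => [|i r IHr].
  by under eq_fun do rewrite big_nil; rewrite big_nil; exact: is_derive_cst.
under eq_fun do rewrite big_cons; rewrite big_cons.
by case: ifP => // Pi; apply: is_deriveD => //; exact: h_der.
Qed.

Lemma der_prod_log n (h : 'I_n -> R -> R) (q : 'I_n -> R) t :
  (forall k, der (h k) t (h k t * q k)) ->
  der (fun s => \prod_(k < n) h k s) t (\prod_(k < n) h k t * \sum_(k < n) q k).
Proof.
elim: n h q => [|n IHn] h q h_der.
  by under eq_fun do rewrite big_ord0; rewrite !big_ord0 mulr0; exact: is_derive_cst.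
under eq_fun do rewrite big_ord_recr /=; rewrite !big_ord_recr /=.
have widen_der := IHn _ _ (fun k => h_der (widen_ord (leqnSn n) k)).
by apply: (is_derive_eq (derM widen_der (h_der ord_max))); ring.
Qed.

Lemma der_normalize_log (I : finType) (A : {set I}) (h : I -> R -> R) (q : I -> R) j t
    (p := fun k => normalize A (h^~ t) k) :
  (forall k, k \in A -> 0 < h k t) -> (forall k, k \in A -> der (h k) t (h k t * q k)) ->
  der (fun s => normalize A (h^~ s) j) t (p j * (q j - \sum_k p k * q k)).
Proof.
move=> h_gt0 h_der; rewrite /p /normalize; case: ifP => jA; last first.
  by rewrite mul0r; exact: is_derive_cst.
have total_neq0 : \sum_(k in A) h k t != 0 by rewrite gt_eqF // (sumr_in_gt0 jA).
have total_der := @der_sum I (index_enum _) (mem A) _ _ t h_der.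
apply: (is_derive_eq (der_div total_neq0 (h_der j jA) total_der)).
rewrite (_ : \sum_k _ * q k = (\sum_(k in A) h k t * q k) / \sum_(k in A) h k t); first by field.
rewrite mulr_suml [RHS]big_mkcond; apply: eq_bigr => k _.
by case: ifP => _; rewrite ?mul0r // mulrAC.
Qed.

Lemma der_avoid_log (I : finType) n (h : 'I_n -> I -> R -> R) (d : 'I_n -> I -> R) j t :
  (forall k, h k j t < 1) -> (forall k, der (h k j) t (d k j)) ->
  der (fun s => avoid (fun k j => h k j s) j) t
    (avoid (fun k j => h k j t) j * \sum_(k < n) - (d k j / (1 - h k j t))).
Proof.
move=> h_lt1 h_der; apply: (@der_prod_log n (fun k s => 1 - h k j s)) => k.
apply: (is_derive_eq (der_compl (h_der k))); field.
by rewrite subr_eq0 gt_eqF.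
Qed.

Lemma der_compl_mul_log f g t a b : f t < 1 -> g t < 1 -> der f t a -> der g t b ->
  der (fun s => (1 - f s) * (1 - g s)) t
    ((1 - f t) * (1 - g t) * (- (a / (1 - f t)) - b / (1 - g t))).
Proof.
move=> f_lt1 g_lt1 fa gb; apply: (is_derive_eq (derM (der_compl fa) (der_compl gb))); field.
by rewrite !subr_eq0 !gt_eqF.
Qed.

Lemma der_law_log (I : finType) n (A : {set I}) (h : 'I_n -> I -> R -> R) (d : 'I_n -> I -> R) j t
    (f := law A (fun k j => h k j t)) (q := fun j => \sum_(k < n) - (d k j / (1 - h k j t))) :
  (forall k j, h k j t < 1) -> (forall k j, der (h k j) t (d k j)) ->
  der (fun s => law A (fun k j => h k j s) j) t (f j * (q j - \sum_j f j * q j)).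
Proof.
move=> h_lt1 h_der.
apply: (@der_normalize_log _ A (fun j s => avoid (fun k j => h k j s) j)) => k _.
  by apply: prodr_gt0 => l _; rewrite subr_gt0.
exact: der_avoid_log.
Qed.

Lemma der_dist_le f M : (forall t, 0 <= t <= 1 -> exists2 d, der f t d & `|d| <= M) ->
  `|f 1 - f 0| <= M.
Proof.
move=> f_der.
have deriv t : 0 <= t <= 1 -> derivable f t 1 /\ `|'D_1 f t| <= M.
  by move=> /f_der [d [? <-] d_le].
have [t t01||t t01 ->] := @MVT_segment R f (fun t => 'D_1 f t) 0 1 ler01.
- by apply: derivableP; case: (deriv t) => //; exact: subset_itv_oo_cc.
- by apply: derivable_within_continuous => t t01; case: (deriv t).
by rewrite subr0 mulr1; case: (deriv t).
Qed.

End Derivatives.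

Section Closeness.
Variable R : realType.
Implicit Types (eps x y t d : R) (X : R -> R).

(* [X] moves at speed at most [eps] in the metric [|dx| / Phi x] on [0, 1/2]. *)
Definition slow_at eps X t d : Prop :=
  [/\ 0 <= X t <= 1/2, der X t d & `|d| <= eps * Phi (X t)].

Definition slow_path eps x y X : Prop :=
  [/\ X 0 = x, X 1 = y & forall t, 0 <= t <= 1 -> exists d, slow_at eps X t d].

Definition close eps x y : Prop := exists X, slow_path eps x y X.

Lemma close_range eps x y : close eps x y -> 0 <= x <= 1/2.
Proof. by move=> [X [<- _ /(_ 0)]]; rewrite lexx ler01 => /(_ isT)[d []]. Qed.

Lemma close_refl eps x : 0 <= eps -> 0 <= x <= 1/2 -> close eps x x.
Proof.
move=> eps_ge0 x_rng; exists (fun=> x); split=> // t _; exists 0.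
split=> //; first exact: is_derive_cst.
by rewrite normr0 mulr_ge0 ?Phi_ge0.
Qed.

(* On [1/13, 1/2], [Phi] is smallest at [1/2], and [(1/2 - 1/13) / Phi (1/2) < 200]. *)
Lemma close_segment x y : 1/13 <= x <= 1/2 -> 1/13 <= y <= 1/2 -> close 200 x y.
Proof.
move=> x_rng y_rng; exists (fun t => x + t * (y - x)).
split; rewrite ?mul0r ?addr0 ?mul1r ?subrKC //.
move=> t /andP[t_ge0 t_le1]; exists (0 + (1 * (y - x) + t * 0)).
have between : 1/13 <= x + t * (y - x) <= 1/2 by apply/andP; split; nra.
have slope_der := derM (is_derive_id t 1) (is_derive_cst (y - x) t 1).
split; [lra|exact: is_deriveD (is_derive_cst x t 1) slope_der|].
move: between; set z := x + _ => between; rewrite ler_norml /Phi /kappa /sigma.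
by apply/andP; split; nra.
Qed.

Lemma close_dist eps x y : 0 <= eps -> close eps x y -> `|x - y| <= eps.
Proof.
move=> eps_ge0 [X [<- <- slowX]]; rewrite distrC; apply: der_dist_le => t /slowX[d [_ Xd d_le]].
by exists d => //; apply: le_trans d_le _; rewrite ler_piMr ?Phi_le1.
Qed.

Lemma close_map (K : Type) eps eps' (x x' : K -> R) (F : (K -> R) -> R) :
  (forall k, close eps (x k) (x' k)) ->
  (forall (X : K -> R -> R) (d : K -> R) t, (forall k, slow_at eps (X k) t (d k)) ->
    exists d', slow_at eps' (fun s => F (X^~ s)) t d') ->
  close eps' (F x) (F x').
Proof.
move=> /choice[X pathX] F_slow; exists (fun s => F (X^~ s)); split.
- by congr F; apply: funext => k; have [] := pathX k.
- by congr F; apply: funext => k; have [] := pathX k.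
move=> t t01; have /choice[d slowX] : forall k, exists d, slow_at eps (X k) t d.
  by move=> k; have [_ _ /(_ t t01)] := pathX k.
exact: F_slow slowX.
Qed.

End Closeness.

Section Contraction.
Variable R : realType.
Local Notation lam := (lambda R).
Implicit Types (eps x y t d b : R) (X Y N : R -> R).

Lemma slow_at_compl_div eps b X N t d dN : 0 <= eps -> slow_at eps X t d ->
  der N t dN -> `|dN| <= eps * b -> 2 <= N t ->
  N t * Phi (X t) + (1 - X t) * b <= lam * ((1 - X t) * (kappa R * N t - (1 - X t))) ->
  exists d', slow_at (lam * eps) (fun s => (1 - X s) / N s) t d'.
Proof.
move=> eps_ge0 [X_rng Xd d_le] NdN dN_le N_ge2 contracts.
have N_gt0 : 0 < N t by lra.
exists ((- d * N t - (1 - X t) * dN) / N t ^+ 2); split.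
- by rewrite divr_ge0 ?ler_pdivrMr //; lra.
- by apply: der_div (der_compl Xd) NdN; rewrite gt_eqF.
rewrite /= normrM normfV [`|_ ^+ 2|]gtr0_norm ?ler_pdivrMr ?exprn_gt0 //.
rewrite [leRHS](_ : _ = eps * (lam * ((1 - X t) * (kappa R * N t - (1 - X t))))); last first.
  by rewrite /Phi; field; rewrite gt_eqF.
apply: le_trans (ler_wpM2l eps_ge0 contracts).
rewrite [leRHS](_ : _ = N t * (eps * Phi (X t)) + (1 - X t) * (eps * b)); last by ring.
rewrite [- d * _]mulrC; apply: ler_normB_le; apply: ler_normM_le; rewrite ?normrN //.
  by rewrite gtr0_norm.
by rewrite ger0_norm //; lra.
Qed.

Lemma close_third eps x x' : 0 <= eps -> close eps x x' ->
  close (lam * eps) ((1 - x) / 3) ((1 - x') / 3).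
Proof.
move=> eps_ge0 xx'.
apply: (@close_map R unit eps _ (fun=> x) (fun=> x') (fun z => (1 - z tt) / 3)) => // X d t.
move=> /(_ tt) slowX.
have [X_rng _ _] := slowX.
apply: (@slow_at_compl_div _ 0 (X tt) (fun=> 3) _ _ 0 eps_ge0 slowX).
- exact: is_derive_cst.
- by rewrite normr0 mulr0.
- lra.
- by rewrite /Phi /kappa /sigma /lambda; nra.
Qed.

Lemma close_compl_div eps x x' y y' : 0 <= eps -> close eps x x' -> close eps y y' ->
  close (lam * eps) ((1 - x) / (2 + y)) ((1 - x') / (2 + y')).
Proof.
move=> eps_ge0 xx' yy'.
apply: (@close_map R bool eps _ (fun k => if k then x else y) (fun k => if k then x' else y')
  (fun z => (1 - z true) / (2 + z false))) => [[]|X d t slowX] //.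
have [X_rng _ _] := slowX true; have [Y_rng Yd d_le] := slowX false.
have N_der : der (fun s => 2 + X false s) t (d false).
  by have := is_deriveD (is_derive_cst (2 : R) t 1) Yd; rewrite add0r.
by apply: (slow_at_compl_div eps_ge0 (slowX true) N_der d_le); [lra|exact: compl_div_flux_le].
Qed.

Section TwoLayerPaths.
Variables (n : nat) (A : {set 'I_4}) (i : 'I_4) (eps : R).
Hypotheses (arity : (n + 2 <= #|A| <= 4)%N) (eps_ge0 : 0 <= eps).

Let two_layer (z : 'I_n * 'I_4 + 'I_4 -> R) : R :=
  law [set: 'I_4] (pair_of (law A (fun k j => z (inl (k, j)))) (fun j => z (inr j))) i.

Lemma slow_at_two_layer (X : 'I_n * 'I_4 + 'I_4 -> R -> R)
    (d : 'I_n * 'I_4 + 'I_4 -> R) t :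
  (forall k, slow_at eps (X k) t (d k)) ->
  exists d', slow_at (lam * eps) (fun s => two_layer (X^~ s)) t d'.
Proof.
move=> slowX.
pose xt k j := X (inl (k, j)) t; pose yt j := X (inr j) t; pose f := law A xt.
have xt_rng k j : 0 <= xt k j <= 1/2 by have [] := slowX (inl (k, j)).
have yt_rng j : 0 <= yt j <= 1/2 by have [] := slowX (inr j).
have f_rng j : 0 <= f j <= 4/7.
  by rewrite law_ge0 // (le_trans (law_le arity xt_rng j)) //; case: ifP => _; lra.
have sum_f : \sum_j f j = 1 := sum_law arity xt_rng.
pose q j := \sum_(k < n) - (d (inl (k, j)) / (1 - xt k j)).
have q_le j : `|q j| <= log_rate R n * eps.
  by apply: (log_derivative_le (law_arity_le2 arity)) => // k; have [] := slowX (inl (k, j)).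
have f_der j : der (fun s => law A (fun k j => X (inl (k, j)) s) j) t
    (f j * (q j - \sum_j f j * q j)).
  apply: (@der_law_log R _ n A (fun k j => X (inl (k, j))) (fun k j => d (inl (k, j)))) => k {}j;
    first by have := xt_rng k j; rewrite /xt; lra.
  by have [] := slowX (inl (k, j)).
have f_lt1 j : f j < 1 by have := f_rng j; lra.
have yt_lt1 j : yt j < 1 by have := yt_rng j; lra.
pose a j s := (1 - law A (fun k j => X (inl (k, j)) s) j) * (1 - X (inr j) s).
pose rho j := - (f j * (q j - \sum_j f j * q j) / (1 - f j)) - d (inr j) / (1 - yt j).
have a_der j : der (a j) t (a j t * rho j).
  have [_ Yd _] := slowX (inr j).
  exact: der_compl_mul_log (f_lt1 j) (yt_lt1 j) (f_der j) Yd.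
have a_gt0 j : 0 < a j t by rewrite mulr_gt0 // subr_gt0; [exact: f_lt1|exact: yt_lt1].
have two_layerE s : two_layer (X^~ s) = normalize [set: 'I_4] (a^~ s) i.
  by apply: eq_normalize => j _; exact: avoid_pair.
eexists; split.
- by rewrite two_layerE; exact: two_layer_range.
- under eq_fun do rewrite two_layerE.
  by apply: (@der_normalize_log _ _ [set: 'I_4] a rho) => j _; [exact: a_gt0|exact: a_der].
- rewrite two_layerE; apply: two_layer_contraction => // [|j]; first exact: law_regime.
  by have [] := slowX (inr j).
Qed.

Lemma close_two_layer (x x' : 'I_n -> 'I_4 -> R) (y y' : 'I_4 -> R) :
  (forall k j, close eps (x k j) (x' k j)) -> (forall j, close eps (y j) (y' j)) ->
  close (lam * eps) (law [set: 'I_4] (pair_of (law A x) y) i)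
    (law [set: 'I_4] (pair_of (law A x') y') i).
Proof.
move=> xx' yy'; pose leaves (u : 'I_n -> 'I_4 -> R) (v : 'I_4 -> R) (k : 'I_n * 'I_4 + 'I_4) :=
  match k with inl (k, j) => u k j | inr j => v j end.
apply: (@close_map R _ eps _ (leaves x y) (leaves x' y') two_layer) => [[[k j]|j]|] //=.
exact: slow_at_two_layer.
Qed.

End TwoLayerPaths.
End Contraction.

(** * Exact marginals *)

Section Marginals.
Variables (T : finType) (e : rel T).
Hypotheses (e_sym : symmetric e) (e_irr : irreflexive e).
Implicit Types (S : {set T}) (L : T -> {set 'I_4}) (u v w : T) (i j : 'I_4)
  (c : {ffun T -> 'I_4}) (s ns : seq T).

(* Colorings of the subgraph induced on [S]; outside [S] they take the dummy value [ord0]. *)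
Definition proper_on S L c : bool :=
  [forall u, if u \in S then c u \in L u else c u == ord0] &&
  [forall u in S, forall w in S, e u w ==> (c u != c w)].

Lemma proper_onP S L c : reflect
  [/\ forall u, u \in S -> c u \in L u, forall u, u \notin S -> c u = ord0 &
      forall u w, u \in S -> w \in S -> e u w -> c u != c w] (proper_on S L c).
Proof.
apply: (iffP andP) => [[/forallP values /forall_inP edges]|[inS outS edges]]; split.
- by move=> u uS; have := values u; rewrite uS.
- by move=> u uS; have := values u; rewrite (negbTE uS) => /eqP.
- by move=> u w uS wS; have /forall_inP/(_ w wS)/implyP := edges u uS.
- by apply/forallP => u; case: ifPn => uS; [apply: inS|rewrite outS].
- by apply/forall_inP => u uS; apply/forall_inP => w wS; apply/implyP; apply: edges.
Qed.

Definition nbr S v : {set T} := [set w in S | e v w].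
Definition num_colorings S L : nat := #|[set c | proper_on S L c]|.
Definition num_colorings_at S L v i : nat := #|[set c | proper_on S L c & c v == i]|.

Lemma proper_on_remove S L s j c : {subset s <= S} ->
  proper_on S (remove_on s j L) c = proper_on S L c && (j \notin map c s).
Proof.
move=> sS; apply/proper_onP/andP => [[inS outS edges]|[/proper_onP[inS outS edges] jNs]].
  split; last first.
    by apply/mapP => -[u us jE]; have := inS u (sS u us); rewrite /remove_on us !inE jE eqxx.
  apply/proper_onP; split=> // u uS.
  by have := inS u uS; rewrite /remove_on; case: ifP => // _ /setD1P[].
split=> // u uS; rewrite /remove_on; case: ifP => us; last exact: inS.
by rewrite !inE inS // andbT; apply: contraNneq jNs => <-; exact: map_f.
Qed.

Definition recolor v i c : {ffun T -> 'I_4} := [ffun u => if u == v then i else c u].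

Lemma recolorK v i j c : recolor v i (recolor v j c) = recolor v i c.
Proof. by apply/ffunP => u; rewrite !ffunE; case: eqP. Qed.

Lemma recolor_id v i c : c v = i -> recolor v i c = c.
Proof. by move=> cv; apply/ffunP => u; rewrite ffunE; case: eqP => // ->. Qed.

Lemma map_recolor v i c s : v \notin s -> map (recolor v i c) s = map c s.
Proof. by move=> vNs; apply/eq_in_map => u us; rewrite ffunE; case: eqP us vNs => // -> ->. Qed.

Lemma nbrs_sub S v ns : ns =i nbr S v -> {subset ns <= S :\ v}.
Proof.
move=> nsE u; rewrite nsE !inE => /andP[-> vu]; rewrite andbT.
by apply: contraTneq vu => ->; rewrite e_irr.
Qed.

Lemma proper_on_recolor S L v i c ns : v \in S -> ns =i nbr S v ->
  proper_on S L (recolor v i c) =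
  [&& i \in L v, i \notin map c ns & proper_on (S :\ v) L (recolor v ord0 c)].
Proof.
move=> vS nsE.
have nbrNv u : e v u -> (u == v) = false by apply: contraTF => /eqP->; rewrite e_irr.
apply/proper_onP/and3P => [[inS outS edges]|[iL iNns /proper_onP[inS outS edges]]]; split.
- by have := inS v vS; rewrite ffunE eqxx.
- apply/mapP => -[u]; rewrite nsE inE => /andP[uS vu] iE.
  by have := edges v u vS uS vu; rewrite !ffunE eqxx nbrNv // iE eqxx.
- apply/proper_onP; split=> [u /setD1P[uv uS]|u|u w /setD1P[uv uS] /setD1P[wv wS] uw].
  + by have := inS u uS; rewrite !ffunE (negbTE uv).
  + by rewrite !inE negb_and negbK ffunE; case: eqP => //= uv /outS; rewrite ffunE; case: eqP uv.
  + by have := edges u w uS wS uw; rewrite !ffunE (negbTE uv) (negbTE wv).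
- move=> u uS; rewrite ffunE; case: eqP => [->//|/eqP uv].
  by have := inS u; rewrite !inE uv uS ffunE (negbTE uv) => ->.
- move=> u uS; rewrite ffunE; case: eqP => [uv|/eqP uv]; first by rewrite uv vS in uS.
  by have := outS u; rewrite !inE negb_and uS orbT ffunE (negbTE uv) => ->.
- move=> u w uS wS; rewrite !ffunE; have [->|uv] := eqVneq u v; have [->|wv] := eqVneq w v.
  + by rewrite e_irr.
  + by move=> vw; apply: contraNneq iNns => ->; rewrite map_f // nsE inE wS.
  + by rewrite e_sym => vu; apply: contraNneq iNns => <-; rewrite map_f // nsE inE uS.
  + by move=> uw; have := edges u w; rewrite !inE uv wv uS wS !ffunE (negbTE uv) (negbTE wv) => ->.
Qed.

Lemma num_colorings_sum S L v : num_colorings S L = (\sum_i num_colorings_at S L v i)%N.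
Proof.
rewrite /num_colorings -sum1_card (partition_big (fun c : {ffun T -> 'I_4} => c v) predT) //=.
by apply: eq_bigr => i _; rewrite /num_colorings_at -sum1_card; apply: eq_bigl => c; rewrite !inE.
Qed.

Lemma num_colorings_at_notin S L v i : v \in S -> i \notin L v -> num_colorings_at S L v i = 0%N.
Proof.
move=> vS iL; apply/eqP; rewrite cards_eq0; apply/eqP/setP => c; rewrite !inE.
by apply: contraNF iL => /andP[/proper_onP[inS _ _] /eqP <-]; exact: inS.
Qed.

Lemma num_colorings_at_delete S L v i ns : v \in S -> i \in L v -> ns =i nbr S v ->
  num_colorings_at S L v i = num_colorings (S :\ v) (remove_on ns i L).
Proof.
move=> vS iL nsE; have ns_sub := nbrs_sub nsE.
have vNns : v \notin ns by apply/negP => /ns_sub; rewrite !inE eqxx.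
have recolor_out c : proper_on (S :\ v) L c -> recolor v ord0 c = c.
  by move=> /proper_onP[_ outS _]; rewrite recolor_id // outS // !inE eqxx.
rewrite /num_colorings -(card_in_imset (f := recolor v i)); last first.
  move=> c1 c2; rewrite !inE !proper_on_remove //.
  move=> /andP[/recolor_out + _] /andP[/recolor_out + _] => {2}<- {2}<- c12.
  by rewrite -(recolorK v ord0 i c1) c12 recolorK.
apply: eq_card => c; rewrite !inE; apply/andP/imsetP => [[c_proper /eqP cv]|[c' + ->]].
  exists (recolor v ord0 c); last by rewrite recolorK recolor_id.
  rewrite inE proper_on_remove // map_recolor //; move: c_proper.
  by rewrite -{1}(recolor_id cv) (proper_on_recolor _ _ _ vS nsE) => /and3P[_ -> ->].
rewrite inE proper_on_remove // => /andP[c'_proper iNns].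
by rewrite (proper_on_recolor _ _ _ vS nsE) iL iNns recolor_out // ffunE !eqxx.
Qed.

(* At least [#|L v| - #|nbr S v|] colors remain for [v] given those of the other vertices. *)
Lemma num_colorings_ge_slack S L v : v \in S ->
  ((#|L v| - #|nbr S v|) * num_colorings (S :\ v) L <= num_colorings S L)%N.
Proof.
move=> vS; pose ns := enum (nbr S v); have nsE : ns =i nbr S v by move=> w; rewrite mem_enum.
have free_colors c : (#|L v| - #|nbr S v| <= \sum_(i in L v) (i \notin map c ns))%N.
  rewrite -big_mkcondr sum1_card leq_subLR -(cardID (mem (map c ns)) (L v)) leq_add //.
    rewrite cardE -(size_map c) -/ns.
    apply: leq_trans (subset_leq_card _) (card_size _).
    by apply/subsetP => i; rewrite inE => /andP[].
  by apply: subset_leq_card; apply/subsetP => i; rewrite !inE andbC.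
rewrite (num_colorings_sum S L v) (bigID (mem (L v))) /= (leq_trans _ (leq_addr _ _)) //.
apply: (@leq_trans (\sum_(c in [set c | proper_on (S :\ v) L c])
    \sum_(i in L v) (i \notin map c ns))).
  by rewrite mulnC -sum_nat_const; apply: leq_sum.
rewrite exchange_big /= leq_sum // => i iL.
rewrite (num_colorings_at_delete vS iL nsE) /num_colorings -sum1_card.
rewrite -big_mkcondr /= (eq_leq (eq_bigl _ _ _)) // => c.
by rewrite !inE proper_on_remove //; exact: nbrs_sub.
Qed.

Definition valid S L := forall u, u \in S -> (#|nbr S u| < #|L u|)%N.

Lemma card_nbr_delete S u v : v \in S -> e v u -> #|nbr S u| = #|nbr (S :\ v) u|.+1.
Proof.
move=> vS evu; rewrite (cardsD1 v) inE vS e_sym evu add1n; congr _.+1.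
by apply: eq_card => w; rewrite !inE andbA.
Qed.

Lemma valid_delete S L v s j : v \in S -> {subset s <= nbr S v} -> valid S L ->
  valid (S :\ v) (remove_on s j L).
Proof.
move=> vS s_sub valid_SL u /setD1P[uv uS]; have slack_u := valid_SL u uS.
rewrite /remove_on; case: ifPn => us; last first.
  apply: leq_ltn_trans slack_u; apply/subset_leq_card/subsetP => w.
  by rewrite !inE => /andP[/andP[_ ->] ->].
have /setIdP[_ vu] := s_sub u us.
by move: slack_u; rewrite (card_nbr_delete vS vu) (cardsD1 j (L u)); case: (j \in L u) => // /ltnW.
Qed.

Lemma num_colorings_gt0 S L : valid S L -> (0 < num_colorings S L)%N.
Proof.
have [n] := ubnP #|S|; elim: n S L => // n IHn S L; rewrite ltnS => leSn valid_SL.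
have [->|[v vS]] := set_0Vmem S.
  rewrite card_gt0; apply/set0Pn; exists [ffun=> ord0]; rewrite inE; apply/proper_onP.
  by split=> [u|u _|u w]; rewrite ?inE ?ffunE.
apply: leq_trans (num_colorings_ge_slack L vS); rewrite muln_gt0 subn_gt0 valid_SL //=; apply: IHn.
  by move: leSn; rewrite (cardsD1 v S) vS.
by apply: (@valid_delete S L v [::] ord0).
Qed.

Lemma num_colorings_remove S L u j s : u \in S -> {subset s <= S} ->
  num_colorings S (remove_on s j L) =
  (num_colorings_at S (remove_on s j L) u j + num_colorings S (remove_on (rcons s u) j L))%N.
Proof.
move=> uS sS; rewrite /num_colorings -(cardsID [set c : {ffun T -> 'I_4} | c u == j]).
congr (_ + _)%N; apply: eq_card => c; rewrite !inE // !proper_on_remove //.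
  by rewrite map_rcons mem_rcons inE negb_or [j == _]eq_sym andbCA.
by move=> w; rewrite mem_rcons inE => /predU1P[->//|/sS].
Qed.

Variable R : realFieldType.

Definition marginal S L v i : R := (num_colorings_at S L v i)%:R / (num_colorings S L)%:R.

(* The values of [p] at the queries that the recursion makes at [v]. *)
Definition children (p : {set T} -> (T -> {set 'I_4}) -> T -> 'I_4 -> R) S L v ns
    (k : 'I_(size ns)) j : R :=
  p (S :\ v) (remove_on (take k ns) j L) (nth v ns k) j.

Lemma children_head p S L v u s j : @children p S L v (u :: s) ord0 j = p (S :\ v) L u j.
Proof. by []. Qed.

Lemma marginal_notin S L v i : v \in S -> i \notin L v -> marginal S L v i = 0.
Proof. by move=> vS iL; rewrite /marginal num_colorings_at_notin // mul0r. Qed.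

Lemma marginal_ge0 S L v i : 0 <= marginal S L v i.
Proof. exact: divr_ge0. Qed.

Lemma marginal_slack_le S L v i : v \in S -> valid S L ->
  (#|L v| - #|nbr S v|)%:R * marginal S L v i <= 1.
Proof.
move=> vS valid_SL; have [iL|iL] := boolP (i \in L v); last by rewrite marginal_notin // mulr0.
rewrite /marginal mulrA ler_pdivrMr ?ltr0n ?num_colorings_gt0 // mul1r -natrM ler_nat.
apply: leq_trans (num_colorings_ge_slack L vS); rewrite leq_mul2l orbC.
rewrite (@num_colorings_at_delete _ _ _ _ (enum (nbr S v))) // => [|w]; last by rewrite mem_enum.
rewrite subset_leq_card //; apply/subsetP => c; rewrite !inE proper_on_remove // => [/andP[]//|].
by apply: nbrs_sub => w; rewrite mem_enum.
Qed.

Lemma sum_marginal S L v : valid S L -> \sum_i marginal S L v i = 1.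
Proof.
move=> valid_SL; rewrite -mulr_suml -natr_sum -num_colorings_sum divff // pnatr_eq0 -lt0n.
exact: num_colorings_gt0.
Qed.

(* The colors of the neighbours are revealed one at a time. *)
Lemma num_colorings_remove_prod S L v ns i m : v \in S -> ns =i nbr S v -> valid S L ->
  (m <= size ns)%N ->
  (num_colorings (S :\ v) (remove_on (take m ns) i L))%:R = (num_colorings (S :\ v) L)%:R *
  \prod_(k < m) (1 - marginal (S :\ v) (remove_on (take k ns) i L) (nth v ns k) i) :> R.
Proof.
move=> vS nsE valid_SL; elim: m => [|m IHm] m_lt; first by rewrite big_ord0 mulr1 take0.
have ns_sub := nbrs_sub nsE.
have take_sub : {subset take m ns <= S :\ v} by move=> w /mem_take/ns_sub.
have valid_m : valid (S :\ v) (remove_on (take m ns) i L).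
  by apply: valid_delete => // w /mem_take; rewrite nsE.
have nth_in : nth v ns m \in S :\ v by rewrite ns_sub ?mem_nth.
rewrite big_ord_recr /= mulrA -IHm ?(ltnW m_lt) // (take_nth v m_lt).
have total_neq0 : (num_colorings (S :\ v) (remove_on (take m ns) i L))%:R != 0 :> R.
  by rewrite pnatr_eq0 -lt0n num_colorings_gt0.
rewrite mulrBr mulr1 mulrCA divff // mulr1 (num_colorings_remove L i nth_in take_sub) natrD.
by rewrite [RHS]addrAC subrr add0r.
Qed.

Lemma marginal_law S L v ns i : v \in S -> ns =i nbr S v -> valid S L ->
  marginal S L v i = law (L v) (@children marginal S L v ns) i.
Proof.
move=> vS nsE valid_SL; rewrite /law /normalize; case: ifPn => iL; last exact: marginal_notin.
set x := @children marginal S L v ns.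
have num_colorings_atE j : j \in L v ->
    (num_colorings_at S L v j)%:R = (num_colorings (S :\ v) L)%:R * avoid x j :> R.
  move=> jL; rewrite (num_colorings_at_delete vS jL nsE) -[ns in LHS]take_size.
  exact: num_colorings_remove_prod.
have num_coloringsE : (num_colorings S L)%:R =
    (num_colorings (S :\ v) L)%:R * \sum_(j in L v) avoid x j :> R.
  rewrite (num_colorings_sum S L v) natr_sum mulr_sumr.
  rewrite (bigID (mem (L v))) /= [X in _ + X]big1 ?addr0.
    by apply: eq_bigr => j; exact: num_colorings_atE.
  by move=> j jL; rewrite num_colorings_at_notin.
rewrite /marginal num_colorings_atE // num_coloringsE invfM mulrACA divff ?mul1r //.
rewrite pnatr_eq0 -lt0n num_colorings_gt0 //.
by apply: (@valid_delete S L v [::] i).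
Qed.

Definition has_spare S L v := [/\ v \in S, valid S L & (#|nbr S v| + 2 <= #|L v|)%N].

Lemma spare_child S L v ns j k : v \in S -> valid S L -> uniq ns -> ns =i nbr S v ->
  (k < size ns)%N -> has_spare (S :\ v) (remove_on (take k ns) j L) (nth v ns k).
Proof.
move=> vS valid_SL ns_uniq nsE k_lt; have nth_in : nth v ns k \in ns by rewrite mem_nth.
have /setIdP[nth_S v_nth] : nth v ns k \in nbr S v by rewrite -nsE.
split; first exact: nbrs_sub nth_in.
  by apply: valid_delete => // w /mem_take; rewrite nsE.
have /negbTE nth_notin : nth v ns k \notin take k ns.
  by rewrite in_take_leq ?index_uniq ?ltnn // ltnW.
by rewrite /remove_on nth_notin addn2 -(card_nbr_delete vS v_nth) valid_SL.
Qed.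

Lemma marginal_range S L v i : has_spare S L v -> 0 <= marginal S L v i <= 1/2.
Proof.
move=> [vS valid_SL slack]; rewrite marginal_ge0 ler_pdivlMr // mulrC.
apply: le_trans (marginal_slack_le i vS valid_SL); rewrite ler_wpM2r ?marginal_ge0 //.
by rewrite ler_nat leq_subRL // (leq_trans _ slack) // leq_addr.
Qed.

Lemma spare_size S L v ns : uniq ns -> ns =i nbr S v -> has_spare S L v ->
  (size ns + 2 <= #|L v| <= 4)%N.
Proof.
move=> ns_uniq nsE [_ _]; rewrite -(eq_card nsE) (card_uniqP ns_uniq) => -> /=.
by apply: leq_trans (max_card _) _; rewrite card_ord.
Qed.

Lemma marginal_ge S L v i : has_spare S L v -> i \in L v -> 1/13 <= marginal S L v i.
Proof.
move=> spare_v iL; have [vS valid_SL _] := spare_v.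
have ns_uniq := enum_uniq (nbr S v).
have nsE : enum (nbr S v) =i nbr S v by move=> w; rewrite mem_enum.
rewrite (marginal_law _ vS nsE valid_SL); apply: law_ge => //.
  exact: spare_size spare_v.
by move=> k j; apply: marginal_range; exact: spare_child.
Qed.

End Marginals.

(** * The recursion *)

Section SmallLaws.
Variables (R : realFieldType) (I : finType) (A : {set I}) (j : I).

Lemma law_arity0 (x : 'I_0 -> I -> R) : j \in A -> law A x j = #|A|%:R^-1.
Proof.
move=> jA; rewrite /law /normalize jA /avoid big_ord0 div1r.
by under eq_bigr do rewrite big_ord0; rewrite sumr_const.
Qed.

Lemma law_arity1 (x : 'I_1 -> I -> R) : j \in A ->
  law A x j = (1 - x ord0 j) / \sum_(k in A) (1 - x ord0 k).
Proof.
move=> jA; rewrite /law /normalize jA /avoid big_ord1.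
by under eq_bigr do rewrite big_ord1.
Qed.

Lemma sum_compl (x : I -> R) : \sum_k x k = 1 ->
  \sum_(k in A) (1 - x k) = #|A|%:R - 1 + \sum_(k in ~: A) x k.
Proof.
have -> : \sum_(k in ~: A) x k = \sum_(k | k \notin A) x k by apply: eq_bigl => k; rewrite inE.
by rewrite (bigID (mem A)) /= sumrB sumr_const => <-; ring.
Qed.

End SmallLaws.

Section Procedure.
Variables (R : realFieldType) (T : finType) (nb : {set T} -> T -> seq T).
Implicit Types (S : {set T}) (L : T -> {set 'I_4}) (v a b c : T) (i j : 'I_4) (D : nat).
Local Notation P := (@P R T nb).

Lemma P_notin D S L v i : i \notin L v -> P D S L v i = 0.
Proof. by case: D => [|D] /= ->. Qed.

Lemma P_isolated D S L v i : i \in L v -> nb S v = [::] -> P D S L v i = inv_card R (L v).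
Proof. by case: D => [|D] /= -> // ->. Qed.

Lemma P_leaf_card2 D S L v a i : i \in L v -> nb S v = [:: a] -> #|L v| = 2%N ->
  P D.+1 S L v i = law (L v) (@children T R (P D) S L v [:: a]) i.
Proof.
move=> iL nbE card2; rewrite law_arity1 // (big_setD1 i iL) /= iL nbE card2 /=.
have /cards1P[j LE] : #|L v :\ i| == 1%N by move: card2; rewrite (cardsD1 i) iL add1n => -[->].
rewrite LE big_set1; case: pickP => [k|/(_ j)]; rewrite inE ?eqxx // => /eqP ->.
by rewrite !children_head /=; congr (_ / _); ring.
Qed.

Lemma P_leaf_card3 D S L v a i j : i \in L v -> nb S v = [:: a] -> #|L v| = 3%N -> j \notin L v ->
  P D.+1 S L v i = (1 - P D (S :\ v) L a i) / (2 + P D (S :\ v) L a j).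
Proof.
move=> iL nbE card3 jL; rewrite /= iL nbE card3 /=.
have /cards1P[k LE] : #|~: L v| == 1%N by rewrite cardsCs setCK card_ord card3.
have missing k' : (k' \notin L v) = (k' == k) by rewrite -in_setC LE inE.
case: pickP => [k'|/(_ j)]; last by rewrite jL.
by rewrite missing => /eqP->; move: jL; rewrite missing => /eqP->.
Qed.

Lemma P_leaf_card4 D S L v a i : i \in L v -> nb S v = [:: a] -> #|L v| = 4%N ->
  P D.+1 S L v i = (1 - P D (S :\ v) L a i) / 3.
Proof. by move=> iL nbE card4; rewrite /= iL nbE card4. Qed.

Definition nbr_order S L i a b : T * T :=
  let da := size (nb S a) in let db := size (nb S b) in
  if (da < db)%N || [&& da == 1%N, db == 1%N, i \notin L a & i \in L b] then (b, a) else (a, b).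

Lemma P_pair D S L v a b i (v1 := (nbr_order S L i a b).1) (v2 := (nbr_order S L i a b).2) :
  i \in L v -> nb S v = [:: a; b] ->
  P D.+1 S L v i = law (L v) (pair_of
    (law (L v1) (@children T R (P D) (S :\ v) L v1 (nb (S :\ v) v1)))
    (fun j => P D (S :\ v) (remove_on [:: v1] j L) v2 j)) i.
Proof.
move=> iL nbE; pose us := nb (S :\ v) v1.
have first_lawE j : law (L v1) (@children T R (P D) (S :\ v) L v1 us) j =
    if j \in L v1 then \prod_(k < size us)
        (1 - P D (S :\ v :\ v1) (remove_on (take k us) j L) (nth v us k) j) /
      \sum_(w in L v1) \prod_(k < size us)
        (1 - P D (S :\ v :\ v1) (remove_on (take k us) w L) (nth v us k) w) else 0.
  rewrite /law /normalize; case: ifP => // _.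
  by congr (_ / _); [|apply: eq_bigr => w _]; apply: eq_bigr => k _;
    rewrite /children (set_nth_default v).
rewrite {1}/law /normalize iL avoid_pair; under eq_bigr do rewrite avoid_pair first_lawE.
rewrite first_lawE /us /v1 /v2 /nbr_order /= iL nbE.
by set swap := (_ || _); case: swap.
Qed.

Lemma P_triple D S L v a b c i : i \in L v -> nb S v = [:: a; b; c] ->
  P D.+1 S L v i = law (L v) (@children T R (P D) S L v [:: a; b; c]) i.
Proof.
move=> iL nbE; rewrite /law /normalize iL /= iL nbE.
have avoidE j : avoid (@children T R (P D) S L v [:: a; b; c]) j =
    (1 - P D (S :\ v) (remove_on [::] j L) a j) * (1 - P D (S :\ v) (remove_on [:: a] j L) b j)
    * (1 - P D (S :\ v) (remove_on [:: a; b] j L) c j).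
  by rewrite /avoid !big_ord_recl big_ord0 mulr1 mulrA.
by rewrite avoidE; under [X in _ = _ / X]eq_bigr do rewrite avoidE.
Qed.

End Procedure.

Section Neighbours.
Variables (R : realFieldType) (T : finType) (e : rel T) (nb : {set T} -> T -> seq T).
Hypotheses (e_sym : symmetric e) (e_irr : irreflexive e) (nb_enum : nb_ok e nb).
Implicit Types (S : {set T}) (L : T -> {set 'I_4}) (v a b : T) (i j : 'I_4).
Local Notation marginal := (marginal e R).
Local Notation has_spare := (has_spare e).
Local Notation valid := (valid e).

Lemma nb_uniq S v : uniq (nb S v).
Proof. by have [] := nb_enum S v. Qed.

Lemma nb_nbr S v : nb S v =i nbr e S v.
Proof. by move=> w; have [_ ->] := nb_enum S v; rewrite inE. Qed.

Lemma size_nb S v : size (nb S v) = #|nbr e S v|.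
Proof. by rewrite -(eq_card (nb_nbr S v)) (card_uniqP (nb_uniq S v)). Qed.

Lemma spare_arity S L v : has_spare S L v -> (size (nb S v) + 2 <= #|L v| <= 4)%N.
Proof. exact: spare_size (nb_uniq S v) (nb_nbr S v). Qed.

Lemma nbr_order_enum S L v i a b (v1 := (nbr_order nb S L i a b).1)
    (v2 := (nbr_order nb S L i a b).2) :
  nb S v = [:: a; b] -> uniq [:: v1; v2] /\ [:: v1; v2] =i nbr e S v.
Proof.
move=> nbE; have := nb_uniq S v; have := nb_nbr S v; rewrite nbE /v1 /v2 /nbr_order => abE ab_uniq.
case: ifP => _ //=; split; first by move: ab_uniq; rewrite /= !inE eq_sym.
by move=> w; rewrite -abE !inE orbC.
Qed.

Lemma marginal_isolated S L v i : v \in S -> valid S L -> i \in L v -> nb S v = [::] ->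
  marginal S L v i = inv_card R (L v).
Proof.
move=> vS valid_SL iL nbE; have := nb_nbr S v; rewrite nbE => nsE.
by rewrite (marginal_law e_sym e_irr R i vS nsE valid_SL) law_arity0.
Qed.

Lemma spare_pair S L v a b j : v \in S -> valid S L -> uniq [:: a; b] -> [:: a; b] =i nbr e S v ->
  has_spare (S :\ v) L a /\ has_spare (S :\ v) (remove_on [:: a] j L) b.
Proof.
move=> vS valid_SL ns_uniq nsE.
have child k := spare_child (k := k) e_sym e_irr j vS valid_SL ns_uniq nsE.
by split; [exact: (child 0%N)|exact: (child 1%N)].
Qed.

Lemma marginal_pair S L v a b i :
  v \in S -> valid S L -> uniq [:: a; b] -> [:: a; b] =i nbr e S v ->
  marginal S L v i = law (L v) (pair_of
    (law (L a) (@children T R marginal (S :\ v) L a (nb (S :\ v) a)))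
    (fun j => marginal (S :\ v) (remove_on [:: a] j L) b j)) i.
Proof.
move=> vS valid_SL ns_uniq nsE; rewrite (marginal_law e_sym e_irr R i vS nsE valid_SL).
have [[aS valid_a _] _] := spare_pair i vS valid_SL ns_uniq nsE.
apply: eq_law => k j; case: k => -[|[|//]] k_lt //=.
exact: marginal_law aS (nb_nbr _ _) valid_a.
Qed.

Lemma spare_children S L v j k : v \in S -> valid S L -> (k < size (nb S v))%N ->
  has_spare (S :\ v) (remove_on (take k (nb S v)) j L) (nth v (nb S v) k).
Proof. by move=> vS valid_SL; apply: spare_child; rewrite ?nb_uniq // => w; exact: nb_nbr. Qed.

End Neighbours.

Section ErrorDecay.
Variables (R : realType) (T : finType) (e : rel T) (nb : {set T} -> T -> seq T).
Hypotheses (e_sym : symmetric e) (e_irr : irreflexive e) (nb_enum : nb_ok e nb).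
Implicit Types (S : {set T}) (L : T -> {set 'I_4}) (v a b c : T) (i j : 'I_4) (D : nat).
Local Notation P := (@P R T nb).
Local Notation marginal := (marginal e R).
Local Notation has_spare := (has_spare e).
Local Notation valid := (valid e).

Definition err D : R := 200 * lambda R ^+ D.

Lemma lambda_ge0 : 0 <= lambda R.
Proof. exact: divr_ge0. Qed.

Lemma err_ge0 D : 0 <= err D.
Proof. by rewrite mulr_ge0 // exprn_ge0 // lambda_ge0. Qed.

Lemma errS D : err D.+1 = lambda R * err D.
Proof. by rewrite /err exprS mulrCA. Qed.

Definition depth_close D : Prop := forall S L v i,
  has_spare S L v -> close (err D) (P D S L v i) (marginal S L v i).

Lemma P_close_notin D S L v i : has_spare S L v -> i \notin L v ->
  close (err D) (P D S L v i) (marginal S L v i).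
Proof.
move=> [vS _ _] iL; rewrite P_notin // marginal_notin //.
by apply: close_refl; [exact: err_ge0|rewrite lexx divr_ge0].
Qed.

Lemma depth_close0 : depth_close 0.
Proof.
move=> S L v i spare_v; have [iL|iL] := boolP (i \in L v); last exact: P_close_notin.
rewrite /= iL /err expr0 mulr1; apply: close_segment.
  have /andP[card_ge card_le] := spare_arity nb_enum spare_v; rewrite /inv_card.
  move: card_ge; rewrite addnC => /(leq_trans (leq_addr _ _)).
  by move: card_le; case: #|L v| => [|[|[|[|[|//]]]]] // _ _; lra.
by rewrite marginal_ge //=; case/andP: (marginal_range e_sym e_irr R i spare_v).
Qed.

Lemma depth_close_leaf D S L v a i :
  depth_close D -> has_spare S L v -> i \in L v -> nb S v = [:: a] ->
  close (err D.+1) (P D.+1 S L v i) (marginal S L v i).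
Proof.
move=> IH spare_v iL nbE; have [vS valid_SL _] := spare_v.
have ns_uniq := nb_uniq nb_enum S v; have nsE := nb_nbr nb_enum S v; rewrite nbE in ns_uniq nsE.
have /andP[card_ge card_le] := spare_arity nb_enum spare_v; rewrite nbE in card_ge.
have spare_a : has_spare (S :\ v) L a :=
  @spare_child _ _ e_sym e_irr S L v [:: a] i 0 vS valid_SL ns_uniq nsE isT.
have sum_a := sum_marginal e_sym e_irr R a (let: And3 _ h _ := spare_a in h).
rewrite (marginal_law e_sym e_irr R i vS nsE valid_SL) law_arity1 // errS.
under [X in close _ _ (_ / X)]eq_bigr do rewrite children_head.
rewrite children_head sum_compl //.
move: card_le; rewrite leq_eqVlt => /orP[/eqP card4|card_lt4].
  rewrite (P_leaf_card4 R D iL nbE card4) card4 (@full_colors (L v)) ?card4 // setCT big_set0 addr0.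
  by rewrite (_ : 4 - 1 = 3); [apply: close_third; [exact: err_ge0|exact: IH]|ring].
have card3 : #|L v| = 3%N by apply/eqP; rewrite eqn_leq -ltnS card_lt4.
have /cards1P[j jE] : #|~: L v| == 1%N by rewrite cardsCs setCK card_ord card3.
have jL : j \notin L v by rewrite -in_setC jE inE.
rewrite (P_leaf_card3 R D iL nbE card3 jL) card3 jE big_set1 (_ : 3 - 1 = 2); last by ring.
by apply: close_compl_div; [exact: err_ge0|exact: IH|exact: IH].
Qed.

Lemma depth_close_pair D S L v a b i :
  depth_close D -> has_spare S L v -> i \in L v -> nb S v = [:: a; b] ->
  close (err D.+1) (P D.+1 S L v i) (marginal S L v i).
Proof.
move=> IH spare_v iL nbE; have [vS valid_SL _] := spare_v.
have /andP[card_ge _] := spare_arity nb_enum spare_v; rewrite nbE in card_ge.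
have LE : L v = setT := full_colors card_ge.
rewrite (P_pair R D iL nbE); have [ns_uniq nsE] := nbr_order_enum nb_enum L i nbE.
move: ns_uniq nsE; set v1 := (nbr_order _ _ _ _ _ _).1; set v2 := (nbr_order _ _ _ _ _ _).2.
move=> ns_uniq nsE; rewrite (marginal_pair R e_sym e_irr nb_enum i vS valid_SL ns_uniq nsE) LE errS.
have spare_nbrs j := spare_pair e_sym e_irr j vS valid_SL ns_uniq nsE.
have [spare_v1 _] := spare_nbrs i.
have [v1S valid1 _] := spare_v1.
apply: (close_two_layer i (spare_arity nb_enum spare_v1) (err_ge0 D)) => [k j|j].
  by apply: IH; exact: spare_children.
by apply: IH; have [] := spare_nbrs j.
Qed.

Lemma depth_closeP D : depth_close D.
Proof.
elim: D => [|D IH]; first exact: depth_close0.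
move=> S L v i spare_v; have [iL|iL] := boolP (i \in L v); last exact: P_close_notin.
have [vS valid_SL _] := spare_v.
case nbE : (nb S v) => [|a [|b [|c s]]].
- rewrite P_isolated // -(marginal_isolated R e_sym e_irr nb_enum vS valid_SL iL nbE).
  by apply: close_refl; [exact: err_ge0|exact: marginal_range].
- exact: depth_close_leaf nbE.
- exact: depth_close_pair nbE.
- by have /andP[/leq_trans/[apply]] := spare_arity nb_enum spare_v; rewrite nbE addn2.
Qed.

Lemma P_range D S L v i : has_spare S L v -> 0 <= P D S L v i <= 1/2.
Proof. by move=> spare_v; exact: close_range (depth_closeP D i spare_v). Qed.

Lemma P_dist D S L v i : has_spare S L v -> `|P D S L v i - marginal S L v i| <= err D.
Proof. by move=> spare_v; apply: close_dist (err_ge0 D) (depth_closeP D i spare_v). Qed.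

Lemma law_children_dist D S L v i : v \in S -> valid S L -> (size (nb S v) <= 3)%N ->
  `|law (L v) (@children T R (P D) S L v (nb S v)) i - marginal S L v i| <= 200 * err D.
Proof.
move=> vS valid_SL deg_le3; rewrite (marginal_law e_sym e_irr R i vS (nb_nbr nb_enum S v) valid_SL).
have half01 : 0 <= (1/2 : R) < 1 by lra.
apply: le_trans (law_dist_le _ i deg_le3 half01 (err_ge0 D) _ _ _) _.
- by move=> k j; apply: P_range; exact: spare_children.
- by move=> k j; apply: marginal_range => //; exact: spare_children.
- by move=> k j; apply: P_dist; exact: spare_children.
- rewrite [leLHS](_ : _ = 120 * err D); last by field.
  by have := err_ge0 D; lra.
Qed.

Lemma P_pair_dist D S L v a b i : v \in S -> valid S L -> i \in L v -> nb S v = [:: a; b] ->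
  `|P D.+1 S L v i - marginal S L v i| <= 2200 * err D.
Proof.
move=> vS valid_SL iL nbE; rewrite (P_pair R D iL nbE).
have [ns_uniq nsE] := nbr_order_enum nb_enum L i nbE; move: ns_uniq nsE.
set v1 := (nbr_order _ _ _ _ _ _).1; set v2 := (nbr_order _ _ _ _ _ _).2 => ns_uniq nsE.
rewrite (marginal_pair R e_sym e_irr nb_enum i vS valid_SL ns_uniq nsE).
have spare_nbrs j := spare_pair e_sym e_irr j vS valid_SL ns_uniq nsE.
have [spare_v1 _] := spare_nbrs i.
have [v1S valid1 _] := spare_v1.
apply: (law_pair_dist_le (L v) i (spare_arity nb_enum spare_v1) (err_ge0 D)).
- by move=> k j; apply: P_range; exact: spare_children.
- by move=> k j; apply: marginal_range => //; exact: spare_children.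
- by move=> k j; apply: P_dist; exact: spare_children.
- by move=> j; exact: P_range (spare_nbrs j).2.
- by move=> j; apply: marginal_range => //; exact: (spare_nbrs j).2.
- by move=> j; exact: P_dist (spare_nbrs j).2.
Qed.

Lemma P_root_dist D S L v i : v \in S -> valid S L ->
  `|P D.+1 S L v i - marginal S L v i| <= 2200 * err D.
Proof.
move=> vS valid_SL; have err0 := err_ge0 D.
have [iL|iL] := boolP (i \in L v); last first.
  by rewrite P_notin // marginal_notin // subrr normr0 mulr_ge0.
have [spare_v|tight] := boolP (#|nbr e S v| + 2 <= #|L v|)%N.
  apply: le_trans (P_dist D.+1 i _) _ => //.
  by rewrite errS ler_wpM2r // /lambda; lra.
have card_L : #|L v| = (size (nb S v)).+1.
  apply/eqP; rewrite (size_nb nb_enum) eqn_leq valid_SL // andbT -ltnS ltnNge -addn2 //.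
have law_dist := law_children_dist D i vS valid_SL.
case nbE : (nb S v) card_L law_dist => [|a [|b [|c [|d s]]]] card_L law_dist.
- rewrite P_isolated // (marginal_isolated R e_sym e_irr nb_enum vS valid_SL iL nbE) subrr normr0.
  by rewrite mulr_ge0.
- by rewrite (P_leaf_card2 _ _ iL nbE card_L) (le_trans (law_dist _)) //; lra.
- exact: P_pair_dist nbE.
- by rewrite (P_triple _ _ iL nbE) (le_trans (law_dist _)) //; lra.
- by have := max_card (mem (L v)); rewrite card_ord card_L.
Qed.

End ErrorDecay.

(** * From the reals to ordered fields *)

Section Transfer.
Variables (R1 R2 : realFieldType) (h : {rmorphism R1 -> R2}).
Variables (T : finType) (e : rel T) (nb : {set T} -> T -> seq T).
Implicit Types (S : {set T}) (L : T -> {set 'I_4}) (v : T) (i : 'I_4) (D : nat).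

Lemma rmorph_law n (A : {set 'I_4}) (x : 'I_n -> 'I_4 -> R1) j :
  h (law A x j) = law A (fun k j => h (x k j)) j.
Proof.
have avoidE k : h (avoid x k) = avoid (fun k j => h (x k j)) k.
  by rewrite rmorph_prod; apply: eq_bigr => l _; rewrite rmorphB rmorph1.
rewrite /law /normalize; case: ifP => _; last by rewrite rmorph0.
by rewrite fmorph_div avoidE rmorph_sum; congr (_ / _); apply: eq_bigr => k _.
Qed.

Lemma rmorph_pair (f y : 'I_4 -> R1) k j :
  h (pair_of f y k j) = pair_of (fun j => h (f j)) (fun j => h (y j)) k j.
Proof. by rewrite /pair_of; case: eqP. Qed.

Lemma rmorph_inv_card (A : {set 'I_4}) : h (inv_card R1 A) = inv_card R2 A.
Proof. by rewrite fmorphV rmorph_nat. Qed.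

Lemma rmorph_P D S L v i : h (P R1 nb D S L v i) = P R2 nb D S L v i.
Proof.
elim: D S L v i => [|D IH] S L v i.
  by rewrite /=; case: ifP => _; rewrite ?rmorph0 ?rmorph_inv_card.
have [iL|iL] := boolP (i \in L v); last by rewrite !P_notin ?rmorph0.
case nbE : (nb S v) => [|a [|b [|c [|d s]]]].
- by rewrite !P_isolated ?rmorph_inv_card.
- rewrite /= iL nbE /=; do 3?case: ifP => _; rewrite ?rmorph_inv_card // fmorph_div;
    by rewrite ?rmorphB ?rmorphD ?rmorph1 ?rmorph_nat !IH.
- rewrite !(P_pair _ _ iL nbE) rmorph_law; apply: eq_law => k j; rewrite rmorph_pair.
  rewrite /pair_of; case: eqP => _ //; rewrite rmorph_law; apply: eq_law => l j'.
  exact: IH.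
- by rewrite !(P_triple _ _ iL nbE) rmorph_law; apply: eq_law => k j; exact: IH.
- by rewrite /= iL nbE rmorph_inv_card.
Qed.

Lemma rmorph_Prob L v i : h (Prob R1 e L v i) = Prob R2 e L v i.
Proof. by rewrite fmorph_div !rmorph_nat. Qed.

Lemma rmorph_lambda : h (lambda R1) = lambda R2.
Proof. by rewrite /lambda fmorph_div; congr (_ / _); exact: rmorph_nat. Qed.

End Transfer.

Lemma Prob_marginal (R : realFieldType) (T : finType) (e : rel T) (L : T -> {set 'I_4}) v i :
  Prob R e L v i = marginal e R [set: T] L v i.
Proof.
have properE c : proper_col e L c = proper_on e [set: T] L c.
  rewrite /proper_col /proper_on; congr (_ && _); apply: eq_forallb => u; rewrite inE //=.
  by apply: eq_forallb => w; rewrite inE.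
by rewrite /Prob /marginal; congr (_%:R / _%:R); apply: eq_card => c; rewrite !inE properE.
Qed.

Section Bound.
Variables (T : finType) (e : rel T) (nb : {set T} -> T -> seq T).
Implicit Types (L : T -> {set 'I_4}) (v : T) (i : 'I_4) (D : nat).

Definition error_bound (R : realFieldType) (C : nat) L v i D : Prop :=
  `|P R nb D [set: T] L v i - Prob R e L v i| <= C%:R * lambda R ^+ (D - 3).

Lemma error_bound_rat (R : realFieldType) C L v i D :
  error_bound R C L v i D <-> error_bound rat C L v i D.
Proof.
rewrite /error_bound -(rmorph_P (ratr : rat -> R)) -(rmorph_Prob (ratr : rat -> R)).
rewrite -(rmorph_lambda (ratr : rat -> R)) -(rmorph_nat (ratr : rat -> R) C).
by rewrite -rmorphB -ratr_norm -rmorphXn -rmorphM ler_rat.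
Qed.

Lemma error_bound_real (R : realType) L v i D :
  symmetric e -> irreflexive e -> nb_ok e nb ->
  (forall u, (deg e u + 1 <= #|L u|)%N) -> (3 <= D)%N -> error_bound R (2200 * 200) L v i D.
Proof.
move=> e_sym e_irr nb_enum slack; case: D => [//|D] D_ge3.
have valid_L : valid e [set: T] L.
  move=> u _; move: (slack u); rewrite addn1; congr (_ < _)%N.
  by apply: eq_card => w; rewrite !inE.
rewrite /error_bound Prob_marginal natrM.
apply: le_trans (P_root_dist R e_sym e_irr nb_enum D i (in_setT v) valid_L) _.
rewrite -mulrA ler_wpM2l // ler_wpM2l // ler_wiXn2l ?lambda_ge0 //; first by rewrite /lambda; lra.
by rewrite subSS leq_subr.
Qed.

End Bound.

Theorem theorem13 (R : realFieldType) :
  exists C : R, 0 < C /\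
  forall (T : finType) (e : rel T) (nb : {set T} -> T -> seq T),
    symmetric e -> irreflexive e -> @nb_ok T e nb ->
    forall L : T -> {set 'I_4},
      (forall u : T, (deg e u + 1 <= #|L u|)%N) ->
      forall (v : T) (i : 'I_4) (D : nat), (3 <= D)%N ->
        `| @P R T nb D [set: T] L v i - @Prob R T e L v i |
          <= C * lambda R ^+ (D - 3).
Proof.
exists (2200 * 200)%:R; split=> [|T e nb e_sym e_irr nb_enum L slack v i D D_ge3].
  by rewrite ltr0n muln_gt0.
apply/error_bound_rat.
have := error_bound_real Rdefinitions.R v i e_sym e_irr nb_enum slack D_ge3.
by move/error_bound_rat; exact.
Qed.
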